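(* Any Lamé family of a DC-system consists of parallel surfaces in an appropriate space form; thus, the Dupin cyclides are orthogonal to a normal line congruence in this space form.
   Context: Lie sphere geometry: $\mathbb{R}^{4,2}$ is $\mathbb{R}^6$ with a symmetric bilinear form $\langle\cdot,\cdot\rangle$ of signature $(4,2)$. Points $s=\mathrm{span}\{\mathfrak{s}\}$ of the Lie quadric $\mathbb{P}(\mathcal{L})=\{\mathrm{span}\{\mathfrak{s}\}\,|\,\langle\mathfrak{s},\mathfrak{s}\rangle=0,\ \mathfrak{s}\ne0\}$ are oriented 2-spheres (including points and planes). A contact element is a projective line contained in $\mathbb{P}(\mathcal{L})$; a surface is a Legendre map $f:M^2\to\mathcal{Z}$ into the set $\mathcal Z$ of contact elements with $\langle\mathfrak{s}_1,d\mathfrak{s}_2\rangle=0$ for all sections $s_1,s_2\in f$. Möbius subgeometry: a point sphere complex $\mathfrak{p}$, $\langle\mathfrak{p},\mathfrak{p}\rangle=-1$, is fixed; points are the $v\in\mathbb{P}(\mathcal{L})$ with $\langle\mathfrak{v},\mathfrak{p}\rangle=0$. Spheres $s_1,s_2$ are orthogonal iff $\langle\mathfrak{s}_1,\mathfrak{s}_2+\langle\mathfrak{s}_2,\mathfrak{p}\rangle\mathfrak{p}\rangle=0$. A circle is a pair $(\gamma,\gamma^\perp)$ with $\gamma\subset\mathrm{span}\{\mathfrak{p}\}^\perp$ a 3-dimensional subspace of signature $(2,1)$; its points are the elements of $\mathbb{P}(\gamma\cap\mathcal{L})$. Space forms: a vector $\mathfrak{q}\in\mathbb{R}^{4,2}\setminus\{0\}$,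 $\mathfrak{q}\perp\mathfrak{p}$, distinguishes the quadric $\mathcal{Q}=\{\mathfrak{n}\,|\,\langle\mathfrak{n},\mathfrak{n}\rangle=0,\ \langle\mathfrak{n},\mathfrak{q}\rangle=-1,\ \langle\mathfrak{n},\mathfrak{p}\rangle=0\}$ of constant sectional curvature $-\langle\mathfrak{q},\mathfrak{q}\rangle$ (the space form with space form vector $\mathfrak{q}$). A circle $(\gamma,\gamma^\perp)$ is a line (geodesic) in this space form iff $\mathfrak{q}\in\gamma$. Surfaces are parallel in the space form if they are orthogonal surfaces of one common 2-parameter family (normal congruence) of lines of the space form. Dupin cyclide: an orthogonal splitting $\mathbb{R}^{4,2}=D_1\oplus_\perp D_2$ into two 3-dimensional subspaces of signature $(2,1)$; its Legendre map is $(u,v)\mapsto\mathrm{span}\{\mathfrak{s}^1(u),\mathfrak{s}^2(v)\}$, where $s^i$ parametrizes $\mathbb{P}(D_i\cap\mathcal{L})$. Triply orthogonal system: three 1-parameter families of surfaces (coordinate surfaces) such that surfaces of different families intersect orthogonally; a Lamé family is a 1-parameter family of surfaces which is one of these three families. The orthogonal trajectories are the curves of intersection of coordinate surfaces of two different families. A Dupin cyclidic system (DC-system) is a triply orthogonal system where all orthogonal trajectories are circles and at least one Lamé family contains Dupin cyclides. Statements are local, away from singularities. *)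

(* Defs.v *)
From HB Require Import structures.
From mathcomp Require Import all_boot all_order all_algebra.
From mathcomp Require Import all_classical all_reals all_analysis.
Set Implicit Arguments.
Unset Strict Implicit.
Unset Printing Implicit Defensive.
Import Order.TTheory GRing.Theory Num.Theory numFieldNormedType.Exports.
Local Open Scope classical_set_scope.
Local Open Scope ring_scope.

(** * Lie sphere geometry *)

(* The symmetric bilinear form on R^6 with Gram matrix [G]. *)
Definition lie_form (R : realType) (G : 'M[R]_6) (u v : 'rV[R]_6) : R :=
  (u *m G *m v^T) 0 0.

Definition has_signature (R : realType) (G : 'M[R]_6) (U : {vspace 'rV[R]_6})
    (k l : nat) : Prop :=
  exists X : (k + l).-tuple 'rV[R]_6, basis_of U X /\
    forall i j : 'I_(k + l), lie_form G (tnth X i) (tnth X j) =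
      if i == j then (if (i < k)%N then 1 else -1) else 0.

Definition lie_geometry (R : realType) (G : 'M[R]_6) : Prop :=
  G^T = G /\ has_signature G fullv 4 2.

Definition point_sphere_complex (R : realType) (G : 'M[R]_6) (p : 'rV[R]_6) : Prop :=
  lie_form G p p = -1.

(* Spheres and points are represented by their homogeneous coordinates: [s]
   stands for the element span{s} of the Lie quadric. *)
Definition sphere (R : realType) (G : 'M[R]_6) (s : 'rV[R]_6) : Prop :=
  s != 0 /\ lie_form G s s = 0.

Definition point_sphere (R : realType) (G : 'M[R]_6) (p v : 'rV[R]_6) : Prop :=
  sphere G v /\ lie_form G v p = 0.

Definition orthogonal_spheres (R : realType) (G : 'M[R]_6)
    (p s1 s2 : 'rV[R]_6) : Prop :=
  lie_form G s1 (s2 + lie_form G s2 p *: p) = 0.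

Definition contact_element (R : realType) (G : 'M[R]_6)
    (f : {vspace 'rV[R]_6}) : Prop :=
  \dim f = 2%N /\ forall s, s \in f -> lie_form G s s = 0.

(** * Smooth maps and Legendre maps *)

(* C^infinity on [U]: all iterated directional derivatives exist and are
   differentiable on [U].  Only used for open [U]. *)
Definition smooth_on (R : realType) (V W : normedModType R) (U : set V)
    (f : V -> W) : Prop :=
  forall (l : seq V) (x : V), U x ->
    differentiable (foldr (fun v g => 'D_v g) f l) x.

(* A smooth family of [k]-dimensional subspaces (vector bundle of rank [k]):
   locally spanned by [k] smooth, linearly independent sections. *)
Definition smooth_subspaces (R : realType) (V : normedModType R) (U : set V)
    (k : nat) (E : V -> {vspace 'rV[R]_6}) : Prop :=
  forall x, U x -> exists (N : set V) (s : 'I_k -> V -> 'rV[R]_6),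
    [/\ open N, N x, N `<=` U, forall i, smooth_on N (s i)
      & forall y, N y -> basis_of (E y) [tuple s i y | i < k]].

Definition smooth_section (R : realType) (V : normedModType R) (U : set V)
    (E : V -> {vspace 'rV[R]_6}) (s : V -> 'rV[R]_6) : Prop :=
  smooth_on U s /\ forall x, U x -> s x \in E x.

Definition legendre_map (R : realType) (G : 'M[R]_6) (M : set 'rV[R]_2)
    (f : 'rV[R]_2 -> {vspace 'rV[R]_6}) : Prop :=
  [/\ forall y, M y -> contact_element G (f y),
      smooth_subspaces M 2 f
    & forall (W : set 'rV[R]_2) (s1 s2 : 'rV[R]_2 -> 'rV[R]_6),
        open W -> W `<=` M -> smooth_section W f s1 -> smooth_section W f s2 ->
        forall y w, W y -> lie_form G (s1 y) ('D_w s2 y) = 0].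

(** * Circles, lines of a space form, parallel surfaces *)

(* The circle (g, g^perp) is represented by its first component [g]; its points
   are the null directions of [g]. *)
Definition circle (R : realType) (G : 'M[R]_6) (p : 'rV[R]_6)
    (g : {vspace 'rV[R]_6}) : Prop :=
  has_signature G g 2 1 /\ forall u, u \in g -> lie_form G u p = 0.

(* [q] stands for the space form {n | <n,n> = 0, <n,q> = -1, <n,p> = 0} of
   curvature -<q,q>; points of the Lie quadric orthogonal to [q] are its points
   at infinity. *)
Definition space_form_vector (R : realType) (G : 'M[R]_6) (p q : 'rV[R]_6) : Prop :=
  q != 0 /\ lie_form G q p = 0.

Definition space_form_line (R : realType) (G : 'M[R]_6) (p q : 'rV[R]_6)
    (g : {vspace 'rV[R]_6}) : Prop :=
  circle G p g /\ q \in g.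

(* A contact element meets a circle orthogonally if its point lies on the
   circle and its spheres are orthogonal to all spheres through the circle,
   that is, to all null directions of the second component g^perp. *)
Definition meets_orthogonally (R : realType) (G : 'M[R]_6) (p : 'rV[R]_6)
    (f g : {vspace 'rV[R]_6}) : Prop :=
  (exists n, [/\ point_sphere G p n, n \in f & n \in g]) /\
  forall s t, sphere G s -> s \in f ->
    sphere G t -> (forall u, u \in g -> lie_form G t u = 0) ->
    orthogonal_spheres G p s t.

(* 2-parameter families of circles are parametrized over the same domain as
   their orthogonal surfaces, corresponding parameters giving the circle and
   the contact element at which it meets the surface. *)
Definition orthogonal_surface (R : realType) (G : 'M[R]_6) (p : 'rV[R]_6)
    (M : set 'rV[R]_2) (C f : 'rV[R]_2 -> {vspace 'rV[R]_6}) : Prop :=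
  legendre_map G M f /\ forall y, M y -> meets_orthogonally G p (f y) (C y).

Definition line_congruence (R : realType) (G : 'M[R]_6) (p q : 'rV[R]_6)
    (M : set 'rV[R]_2) (C : 'rV[R]_2 -> {vspace 'rV[R]_6}) : Prop :=
  smooth_subspaces M 3 C /\ forall y, M y -> space_form_line G p q (C y).

Definition normal_line_congruence (R : realType) (G : 'M[R]_6) (p q : 'rV[R]_6)
    (M : set 'rV[R]_2) (C : 'rV[R]_2 -> {vspace 'rV[R]_6}) : Prop :=
  line_congruence G p q M C /\ exists f, orthogonal_surface G p M C f.

Definition parallel_surfaces (R : realType) (G : 'M[R]_6) (p q : 'rV[R]_6)
    (M : set 'rV[R]_2) (F : set ('rV[R]_2 -> {vspace 'rV[R]_6})) : Prop :=
  exists C, normal_line_congruence G p q M C /\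
    forall f, F f -> orthogonal_surface G p M C f.

(** * Dupin cyclides *)

Definition dupin_splitting (R : realType) (G : 'M[R]_6)
    (D1 D2 : {vspace 'rV[R]_6}) : Prop :=
  [/\ has_signature G D1 2 1, has_signature G D2 2 1,
      (D1 + D2)%VS = fullv, directv (D1 + D2)
    & forall u1 u2, u1 \in D1 -> u2 \in D2 -> lie_form G u1 u2 = 0].

(* The surface [f] is (a part of) a Dupin cyclide, up to reparametrization: its
   contact elements are of the form span{s1, s2} with s1, s2 on the two conics
   P(D1 /\ L), P(D2 /\ L) of one fixed splitting. *)
Definition dupin_cyclide (R : realType) (G : 'M[R]_6) (M : set 'rV[R]_2)
    (f : 'rV[R]_2 -> {vspace 'rV[R]_6}) : Prop :=
  legendre_map G M f /\
  exists D1 D2, dupin_splitting G D1 D2 /\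
    forall y, M y -> exists s1 s2,
      [/\ sphere G s1 /\ s1 \in D1, sphere G s2 /\ s2 \in D2
        & f y = (<[s1]> + <[s2]>)%VS].

(** * Triply orthogonal systems *)

Definition box (R : realType) (n : nat) (a b : 'rV[R]_n) : set 'rV[R]_n :=
  [set x | forall i, a 0 i < x 0 i < b 0 i].

(* [S i c] is the coordinate surface x_i = c, parametrized by the remaining two
   coordinates [col' i x]. *)
Definition contact_at (R : realType)
    (S : 'I_3 -> R -> 'rV[R]_2 -> {vspace 'rV[R]_6}) (i : 'I_3)
    (x : 'rV[R]_3) : {vspace 'rV[R]_6} :=
  S i (x 0 i) (col' i x).

Definition intersect_orthogonally (R : realType) (G : 'M[R]_6)
    (p n : 'rV[R]_6) (f g : {vspace 'rV[R]_6}) : Prop :=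
  [/\ n \in f, n \in g
    & forall s t, sphere G s -> sphere G t -> s \in f -> t \in g ->
        orthogonal_spheres G p s t].

(* [m x] is a lift of the point at which the three coordinate surfaces through
   the parameter [x] intersect; away from singularities it induces an immersion
   into the space of points, i.e. no nontrivial derivative of [m] is a multiple
   of [m]. *)
Definition triply_orthogonal_system (R : realType) (G : 'M[R]_6)
    (p : 'rV[R]_6) (a b : 'rV[R]_3)
    (S : 'I_3 -> R -> 'rV[R]_2 -> {vspace 'rV[R]_6})
    (m : 'rV[R]_3 -> 'rV[R]_6) : Prop :=
  [/\ forall i c, a 0 i < c < b 0 i ->
        legendre_map G (box (col' i a) (col' i b)) (S i c),
      forall i, smooth_subspaces (box a b) 2 (contact_at S i),
      smooth_on (box a b) m /\ (forall x, box a b x -> point_sphere G p (m x)),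
      forall x w, box a b x -> w != 0 -> 'D_w m x \notin <[m x]>%VS
    & forall i j x, i != j -> box a b x ->
        intersect_orthogonally G p (m x) (contact_at S i x) (contact_at S j x)].

Definition dupin_cyclidic_system (R : realType) (G : 'M[R]_6)
    (p : 'rV[R]_6) (a b : 'rV[R]_3)
    (S : 'I_3 -> R -> 'rV[R]_2 -> {vspace 'rV[R]_6})
    (m : 'rV[R]_3 -> 'rV[R]_6) : Prop :=
  [/\ triply_orthogonal_system G p a b S m,
      (* the curve of intersection of S i c and S j d lies on a circle *)
      forall (i j : 'I_3) (c d : R), i != j ->
        a 0 i < c < b 0 i -> a 0 j < d < b 0 j ->
        exists g, circle G p g /\
          forall x, box a b x -> x 0 i = c -> x 0 j = d -> m x \in g
    & exists (i : 'I_3) (c : R), a 0 i < c < b 0 i /\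
        dupin_cyclide G (box (col' i a) (col' i b)) (S i c)].

(* Main.v *)
Require Import Defs.
From HB Require Import structures.
From mathcomp Require Import all_boot all_order all_algebra.
From mathcomp Require Import all_classical all_reals all_analysis.
From mathcomp Require Import zify ring lra.
Set Implicit Arguments.
Unset Strict Implicit.
Unset Printing Implicit Defensive.
Import Order.TTheory GRing.Theory Num.Theory numFieldNormedType.Exports.
Local Open Scope classical_set_scope.
Local Open Scope ring_scope.

(** Write [m] for a lift of the system into the light cone of p^perp, and let
  gamma_k(x) = span(m, d_k m, d_k^2 m) be the space of the k-th circle through
  m(x).  By Dupin's theorem <d_i d_j m, d_k m> = 0 for distinct i, j, k; hence a
  vector orthogonal to gamma_k makes a constant angle with the surfaces along
  the circle, and the curvature sphere S_ki of the surface x_i = const along its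
  k-th curve, the unit vector of gamma_k^perp congruent to the unit normal
  modulo m, is constant along that curve.  Since S_ik is orthogonal to S_ki and
  S_kj, all S_ik on a surface x_j = c lie in gamma_k(x) for every x on that
  surface, and they span a space E(c) of dimension at least 2; likewise the S_jk
  on x_i = d give F(d).  Projectively, E(c) and F(d) are lines in the plane
  gamma_k, so every line E(c) meets every line F(d).  Either all lines of one
  family pass through a common point q, which then lies in all gamma_k, so that
  the k-th circles are lines of the space form q; or the lines form a regulus or
  lie in a plane.  In the last two cases a surface or a cross of two surfaces
  would lie in a space too small to contain m and its independent derivatives.
    *)

(** * The Lie form *)

Section LieForm.
Context (R : realType) (G : 'M[R]_6).
Local Notation V := 'rV[R]_6.
Local Notation B := (lie_form G).
Implicit Types (u v w : V) (X : seq V) (U : {vspace V}).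

Lemma lieDl u v w : B (u + v) w = B u w + B v w.
Proof. by rewrite /lie_form !mulmxDl mxE. Qed.

Lemma lieZl c u w : B (c *: u) w = c * B u w.
Proof. by rewrite /lie_form -!scalemxAl mxE. Qed.

Lemma lieDr u v w : B w (u + v) = B w u + B w v.
Proof. by rewrite /lie_form raddfD mulmxDr mxE. Qed.

Lemma lieZr c u w : B w (c *: u) = c * B w u.
Proof. by rewrite /lie_form linearZ -scalemxAr mxE. Qed.

Lemma lie0l w : B 0 w = 0.
Proof. by rewrite -(scale0r (0 : V)) lieZl mul0r. Qed.

Lemma lie0r w : B w 0 = 0.
Proof. by rewrite -(scale0r (0 : V)) lieZr mul0r. Qed.

Lemma lieNl u w : B (- u) w = - B u w.
Proof. by rewrite -scaleN1r lieZl mulN1r. Qed.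

Lemma lieNr u w : B w (- u) = - B w u.
Proof. by rewrite -scaleN1r lieZr mulN1r. Qed.

Lemma lie_suml n (F : 'I_n -> V) w : B (\sum_i F i) w = \sum_i B (F i) w.
Proof.
by apply: (big_morph (B^~ w)) => [x y|]; rewrite ?lieDl ?lie0l.
Qed.

Lemma lie_sumr n (F : 'I_n -> V) w : B w (\sum_i F i) = \sum_i B w (F i).
Proof.
by apply: (big_morph (B w)) => [x y|]; rewrite ?lieDr ?lie0r.
Qed.

Definition lieE := (lieDl, lieDr, lieNl, lieNr, lieZl, lieZr, lie0l, lie0r).

Lemma lie_coord u v : B u v = \sum_i \sum_j u 0 j * G j i * v 0 i.
Proof.
by rewrite /lie_form mxE; apply: eq_bigr => i _; rewrite !mxE mulr_suml.
Qed.

Lemma span_perp X w v : {in X, forall x, B w x = 0} -> v \in <<X>>%VS ->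
  B w v = 0.
Proof.
elim: X v => [|x X IH] v wX; first by rewrite span_nil memv0 => /eqP ->;
  rewrite lie0r.
rewrite span_cons => /memv_addP[y /vlineP[c ->] [z zX ->]].
rewrite lieDr lieZr (wX x) ?mem_head// mulr0 add0r; apply: IH zX => t tX.
by apply: wX; rewrite in_cons tX orbT.
Qed.

(** The functional [B w] separates [v] from the span of [X]; frames are proved free by peeling off
    one vector at a time in this way. *)
Lemma free_cons_sep X v w : {in X, forall x, B w x = 0} -> B w v != 0 ->
  free X -> free (v :: X).
Proof.
move=> wX wv fX; rewrite free_cons fX andbT.
by apply: contra wv => vX; rewrite (span_perp wX vX).
Qed.

Context (geoG : lie_geometry G).

Lemma lieC u v : B u v = B v u.
Proof.
have [symG _] := geoG.
have trE (A : 'M[R]_1) : A 0 0 = A^T 0 0 by rewrite mxE.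
by rewrite /lie_form trE !trmx_mul trmxK symG mulmxA.
Qed.

Lemma lie_nondegenerate v : (forall w, B v w = 0) -> v = 0.
Proof.
move=> v0; have [_ [X [Xb XE]]] := geoG.
have [c vE] : exists c, v = \sum_i c i *: tnth X i.
  exists (fun i => coord X i v); rewrite [LHS](coord_basis Xb (memvf v)).
  by apply: eq_bigr => i _; rewrite (tnth_nth 0).
rewrite vE big1// => i _; suff -> : c i = 0 by rewrite scale0r.
have := v0 (tnth X i); rewrite vE lie_suml (bigD1 i)//= big1 => [|j ji].
  rewrite addr0 lieZl XE eqxx; case: ifP => _; first by rewrite mulr1.
  by rewrite mulrN1 => /eqP; rewrite oppr_eq0 => /eqP.
by rewrite lieZl XE (negPf ji) mulr0.
Qed.

Lemma perp_full X v : free X -> size X = 6%N -> {in X, forall x, B v x = 0} ->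
  v = 0.
Proof.
move=> fX sX vX; apply: lie_nondegenerate => w; apply: (span_perp vX).
suff /span_basis -> : basis_of fullv X by exact: memvf.
by rewrite basisEfree fX subvf dimvf /dim/= sX.
Qed.

(** Signature (4,2) provides a positive definite 4-space. In dimension 6 it meets every 3-space in a
    nonzero vector, whose square is positive. *)
Lemma no_seminegative U : (3 <= \dim U)%N -> {in U, forall u, B u u <= 0} ->
  False.
Proof.
move=> dU Uneg; have [_ [X [Xb XE]]] := geoG.
have [Y YE] : exists Y : 4.-tuple V,
    forall i j, B (tnth Y i) (tnth Y j) = (i == j)%:R.
  exists [tuple tnth X (lshift 2 i) | i < 4] => i j.
  by rewrite !tnth_mktuple XE (inj_eq (@lshift_inj _ _)) /= ltn_ord; case: eqP.
have fY : free Y.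
  apply/freeP => k k0 i; have := congr1 (B^~ (tnth Y i)) k0.
  rewrite lie0l lie_suml (bigD1 i)//= big1 => [|j ji].
    by rewrite addr0 lieZl -tnth_nth YE eqxx mulr1.
  by rewrite lieZl -tnth_nth YE (negPf ji) mulr0.
have dY : \dim <<Y>> = 4%N by move: fY; rewrite /free size_tuple => /eqP.
have : (<<Y>> :&: U)%VS != 0%VS.
  rewrite -dimv_eq0 -lt0n; have := dimv_sum_cap <<Y>> U.
  have := dimvS (subvf (<<Y>> + U)%VS); rewrite dimvf /dim/= dY.
  move: dU; move: (\dim U) (\dim (_ + _)) (\dim (_ :&: _)) => a b c; clear; lia.
rewrite -vpick0; set u := vpick _ => u0.
have := memv_pick (<<Y>> :&: U)%VS; rewrite memv_cap -/u => /andP[uY uU].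
have uE := coord_span uY.
have : B u u = \sum_i (coord Y i u) ^+ 2.
  rewrite [X in B X _]uE lie_suml; apply: eq_bigr => i _.
  rewrite lieZl [X in B _ X]uE lie_sumr (bigD1 i)//= big1 => [|j ji].
    by rewrite lieZr -!tnth_nth YE eqxx mulr1 addr0 expr2.
  by rewrite lieZr -!tnth_nth YE eq_sym (negPf ji) mulr0.
have [c0|] := eqVneq (\sum_i coord Y i u ^+ 2) 0; last first.
  move=> s0 uu; have := Uneg u uU; rewrite uu; apply/negP; rewrite -ltNge lt0r
    s0.
  by rewrite sumr_ge0// => i _; exact: sqr_ge0.
move=> _; apply/negP: u0; rewrite negbK uE big1// => i _.
move/psumr_eq0P : c0 => c0; have /eqP := c0 (fun i _ => sqr_ge0 _) i isT.
by rewrite sqrf_eq0 => /eqP ->; rewrite scale0r.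
Qed.

End LieForm.

(** * Curves and coordinate lines *)

Lemma is_derive_lie (R : realType) (G : 'M[R]_6) (W : normedModType R)
    (f g : W -> 'rV[R]_6) (x v : W) (df dg : 'rV[R]_6) :
  is_derive x v f df -> is_derive x v g dg ->
  is_derive x v (fun y => lie_form G (f y) (g y))
    (lie_form G df (g x) + lie_form G (f x) dg).
Proof.
move=> fd gd.
have cd (h : W -> 'rV[R]_6) dh : is_derive x v h dh ->
    forall i, is_derive x v (fun y => h y 0 i) (dh 0 i).
  move=> [hd <-] i; apply: DeriveDef; first by have /derivable_mxP := hd; exact.
  by rewrite derive_mx// mxE.
have -> : (fun y => lie_form G (f y) (g y)) =
    \sum_i \sum_j (fun y => f y 0 j * (G j i * g y 0 i)).
  apply/funext => y; rewrite lie_coord fct_sumE; apply: eq_bigr => i _.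
  by rewrite fct_sumE; apply: eq_bigr => j _; rewrite mulrA.
have H i j : is_derive x v (fun y => f y 0 j * (G j i * g y 0 i))
    (f x 0 j * (G j i * dg 0 i) + (G j i * g x 0 i) * df 0 j).
  have gi := cd _ _ gd i; have fj := cd _ _ fd j.
  have := is_deriveZ (G j i) gi => gz.
  exact: (is_deriveM fj gz).
apply: is_derive_eq (is_derive_sum (fun i => is_derive_sum (H i))) _.
rewrite !lie_coord -big_split/=; apply: eq_bigr => i _.
rewrite -big_split/=; apply: eq_bigr => j _; ring.
Qed.

Section Line.
Context (R : realType) (n : nat).
Implicit Types (x : 'rV[R]_n.+1) (k : 'I_n.+1).

Definition upd x k (s : R) : 'rV[R]_n.+1 :=
  \row_l (if l == k then s else x 0 l).

Definition dir k : 'rV[R]_n.+1 := delta_mx 0 k.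

Lemma upd_id x k : upd x k (x 0 k) = x.
Proof. by apply/rowP => l; rewrite mxE; case: eqP => [->|]. Qed.

Lemma updD x k h s : upd x k (h + s) = h *: dir k + upd x k s.
Proof.
apply/rowP => l; rewrite !mxE eqxx/=.
by case: eqP => _; rewrite ?mulr1// mulr0 add0r.
Qed.

(** The two difference quotients are the same function, since [upd x k] moves affinely in the
    direction [dir k]. *)
Lemma is_derive_upd (W : normedModType R) (f : 'rV[R]_n.+1 -> W) x k s df :
  is_derive (upd x k s) (dir k) f df ->
  is_derive s 1 (fun t => f (upd x k t)) df.
Proof.
have E : (fun h => h^-1 *: (((fun t => f (upd x k t)) \o shift s) (h *: (1 : R))
      - f (upd x k s))) =
    (fun h => h^-1 *: ((f \o shift (upd x k s)) (h *: dir k) - f (upd x k s))).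
  by apply/funext => h /=; rewrite [_ *: (1 : R)]mulr1 updD.
by move=> [fd <-]; apply: DeriveDef; rewrite /derivable /derive E.
Qed.

End Line.

Lemma itv_const (R : realType) (f : R -> R) (a b : R) :
  (forall s, a < s < b -> is_derive s 1 f 0) ->
  forall s t, a < s < b -> a < t < b -> f s = f t.
Proof.
move=> fd s t sab tab; wlog st : s t sab tab / s <= t.
  by move=> H; case: (leP s t) => [|/ltW] ?; [|symmetry]; exact: H.
have in_ab y : s <= y <= t -> a < y < b.
  by case/andP: sab tab => ? ? /andP[? ?] /andP[? ?]; apply/andP; split; lra.
have [y|| c _] := @MVT_segment _ f (cst 0) s t st.
- by rewrite in_itv/= => /andP[? ?]; apply/fd/in_ab/andP; split; exact: ltW.
- apply: continuous_in_subspaceT => y; rewrite inE/= in_itv/= => yst.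
  apply/differentiable_continuous/derivable1_diffP.
  by have [] := fd _ (in_ab _ yst).
by rewrite mul0r => /eqP; rewrite subr_eq0 => /eqP.
Qed.

(** Here [lie_form 1%:M] is the Euclidean dot product, used to represent linear functionals. Some
    coordinate of the projection along [P] is nonzero at [v], and [w] is the row of that coordinate
    functional. *)
Lemma sep_vspace (R : realType) (P : {vspace 'rV[R]_6}) v : v \notin P ->
  exists w, (forall u, u \in P -> lie_form 1%:M u w = 0) /\
    lie_form 1%:M v w != 0.
Proof.
move=> vP; pose L u := u - projv P u.
have /rV0Pn[i Li] : L v != 0.
  apply: contra vP; rewrite subr_eq0 => /eqP ->; exact: memv_proj.
exists (\row_j L (delta_mx 0 j) 0 i).
have dotE u : lie_form 1%:M u (\row_j L (delta_mx 0 j) 0 i) = L u 0 i.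
  rewrite /lie_form mulmx1 [in RHS](row_sum_delta u) /L linear_sum/=.
  rewrite -sumrB summxE mxE; apply: eq_bigr => j _.
  by rewrite !mxE linearZ/= !mxE; ring.
split=> [u uP|]; rewrite dotE//.
by rewrite /L projv_id// subrr mxE.
Qed.

(** A functional that kills [P] vanishes along [f] near [s], hence on the derivative too; it cannot
    separate [df] from [P]. *)
Lemma derive_memv (R : realType) (P : {vspace 'rV[R]_6}) (f : R -> 'rV[R]_6)
    s df :
  (\forall t \near s, f t \in P) -> is_derive s 1 f df -> df \in P.
Proof.
move=> fP fd; apply/negPn/negP => /sep_vspace[w [Pw]]; apply/negP; rewrite
  negbK.
have := @is_derive_lie _ 1%:M _ f (cst w) s 1 df 0 fd (is_derive_cst _ _ _).
rewrite lie0r addr0 => -[_ <-].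
rewrite (@near_eq_derive _ _ _ _ (cst 0)) ?derive_cst//.
by near=> t; apply: Pw; near: t.
Unshelve. all: by end_near. Qed.

(** * Symmetry of second derivatives *)

Lemma differentiable_bound (R : realType) (W : normedModType R) (f : W -> R)
    (x : W) (e : R) : differentiable f x -> 0 < e ->
  exists2 d : R, 0 < d & forall z : W, `|z| < d ->
    `|f (z + x) - f x - 'd f x z| <= e * `|z|.
Proof.
move=> fd e0; have /eqaddoP /(_ e e0) := diff_locally fd.
move=> /nbhs_ballP[d /= d0 H]; exists d => // z zd.
have /H /= : ball (0 : W) d z by rewrite -ball_normE/= sub0r normrN.
by rewrite opprD addrA.
Qed.

Lemma is_derive_line (R : realType) (W V : normedModType R) (f : W -> V)
    (y u : W) (s : R) (df : V) : is_derive (s *: u + y) u f df ->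
  is_derive s 1 (fun t => f (t *: u + y)) df.
Proof.
have E : (fun h => h^-1 *:
      (((fun t => f (t *: u + y)) \o shift s) (h *: (1 : R)) - f (s *: u + y)))
        =
    (fun h => h^-1 *: ((f \o shift (s *: u + y)) (h *: u) - f (s *: u + y))).
  by apply/funext => h /=; rewrite [_ *: (1 : R)]mulr1 scalerDl addrA.
by move=> [fd <-]; apply: DeriveDef; rewrite /derivable /derive E.
Qed.

(** The mean value theorem in the direction [u] turns the second difference into [h] times a
    difference of two values of [fu], which differentiability of [fu] at [x] alone evaluates. *)
Lemma second_difference (R : realType) (W : normedModType R) (f fu : W -> R)
    (x u v : W) (e : R) :
  (\forall y \near x, is_derive y u f (fu y)) ->
  differentiable fu x -> 0 < e ->
  exists2 d : R, 0 < d & forall h, 0 < h < d ->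
    `|f (h *: u + (h *: v + x)) - f (h *: u + x) - f (h *: v + x) + f x
      - h * (h * 'D_v fu x)| <= h * (h * e).
Proof.
move=> /nbhs_ballP[r /= r0 fd] dfd e0; set M := `|u| + `|v| + 1.
have M0 : 0 < M by rewrite /M ltr_wpDl// addr_ge0.
(* Two remainders will occur, each at most e/(2M) times a displacement of norm at most hM, so
   together they cost at most he. *)
have [d1 d10 dfE] := differentiable_bound dfd (divr_gt0 e0 (mulr_gt0 (ltr0n R
  2) M0)).
exists (Num.min r d1 / M); first by rewrite divr_gt0// lt_min r0 d10.
move=> h /andP[h0]; rewrite ltr_pdivlMr// lt_min => /andP[hr hd1].
have le_hM s t : 0 <= s <= h -> 0 <= t <= h -> `|s *: u + t *: v| <= h * M.
  move=> /andP[s0 sh] /andP[t0 th]; apply: (le_trans (ler_normD _ _)).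
  rewrite !normrZ !ger0_norm// /M !mulrDr.
  by rewrite -[leLHS]addr0 lerD ?mulr1 ?(ltW h0)// lerD// ler_wpM2r.
have near_fd s t : 0 <= s <= h -> 0 <= t <= h ->
    is_derive (s *: u + (t *: v + x)) u f (fu (s *: u + (t *: v + x))).
  move=> sh th; apply: fd => /=; rewrite -ball_normE/= addrA opprD addrCA subrr
    addr0.
  by rewrite normrN (le_lt_trans (le_hM _ _ sh th)).
have hh : 0 <= h <= h by rewrite lexx ltW.
have zh : 0 <= (0 : R) <= h by rewrite lexx ltW.
pose g s := f (s *: u + (h *: v + x)) - f (s *: u + (0 *: v + x)).
have gd s : 0 <= s <= h -> is_derive s 1 g
    (fu (s *: u + (h *: v + x)) - fu (s *: u + (0 *: v + x))).
  move=> sh; apply: is_deriveB; apply: is_derive_line; exact: near_fd.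
have [s|| c] := @MVT_segment _ g (fun s => fu (s *: u + (h *: v + x)) -
  fu (s *: u + (0 *: v + x))) 0 h (ltW h0).
- by rewrite in_itv/= => /andP[? ?]; apply: gd; rewrite !ltW.
- apply: continuous_in_subspaceT => y; rewrite inE/= in_itv/= => yh.
  apply/differentiable_continuous/derivable1_diffP.
  by have [] := gd _ yh.
rewrite in_itv/= => ch.
rewrite /g !scale0r !add0r subr0.
have -> : f (h *: u + (h *: v + x)) - f (h *: u + x) - f (h *: v + x) + f x =
  f (h *: u + (h *: v + x)) - f (h *: u + x) - (f (h *: v + x) - f x) by ring.
move=> ->; rewrite [_ * h]mulrC -mulrBr normrM gtr0_norm// ler_pM2l//.
have := dfE (c *: u + h *: v); have := dfE (c *: u + 0 *: v).
move/(_ (le_lt_trans (le_hM _ _ ch zh) hd1)) => h1.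
move/(_ (le_lt_trans (le_hM _ _ ch hh) hd1)) => h2.
rewrite (deriveE _ dfd).
set a1 := fu (c *: u + (h *: v + x)); set a2 := fu (c *: u + x).
have LhE : 'd fu x (h *: v) = h * 'd fu x v by rewrite linearZ.
rewrite -(addrA (c *: u)) -/a1 linearD/= LhE in h2.
rewrite scale0r addr0 -/a2 in h1.
set L := 'd fu x in h1 h2 *.
have -> : a1 - a2 - h * L v =
   (a1 - fu x - (L (c *: u) + h *: L v)) - (a2 - fu x - L (c *: u)).
  rewrite /GRing.scale/=; ring.
apply: (le_trans (ler_normB _ _)); apply: (le_trans (lerD h2 h1)).
have hM1 := le_hM _ _ ch hh; have hM2 := le_hM _ _ ch zh.
rewrite scale0r addr0 in hM2.
rewrite -mulrDr mulrAC ler_pdivrMr ?mulr_gt0//.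
rewrite (_ : h * e * (2 * M) = e * (h * M + h * M)); last by ring.
rewrite ler_pM2l// (le_trans (lerD hM1 hM2))//; lra.
Qed.

(** The second difference is symmetric in [u] and [v], so it approximates both mixed derivatives.
    With a third of their distance as error bound, a common small [h] gives a contradiction. *)
Lemma derive_sym (R : realType) (W : normedModType R) (f fu fv : W -> R)
    (x u v : W) :
  (\forall y \near x, is_derive y u f (fu y)) ->
  (\forall y \near x, is_derive y v f (fv y)) ->
  differentiable fu x -> differentiable fv x ->
  'D_u fv x = 'D_v fu x.
Proof.
move=> fuE fvE dfu dfv; apply/eqP; rewrite -subr_eq0 -normr_eq0.
apply/negPn/negP => nz; have e0 : 0 < `|'D_u fv x - 'D_v fu x| / 3.
  by rewrite divr_gt0// lt0r nz normr_ge0.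
have [d1 d10 H1] := @second_difference _ _ f fu x u v _ fuE dfu e0.
have [d2 d20 H2] := @second_difference _ _ f fv x v u _ fvE dfv e0.
pose h := Num.min d1 d2 / 2.
have m0 : 0 < Num.min d1 d2 by rewrite lt_min d10 d20.
have h0 : 0 < h by rewrite divr_gt0.
have hm : h < Num.min d1 d2 by rewrite /h; move: m0; set m := Num.min _ _; lra.
move: h h0 hm => h h0; rewrite lt_min => /andP[hd1 hd2].
have := H1 h; rewrite h0 hd1 => /(_ isT); have := H2 h; rewrite h0 hd2 => /(_
  isT).
rewrite (addrCA (h *: v)); move: e0.
set a := 'D_u fv x; set b := 'D_v fu x.
set p := f (h *: u + (h *: v + x)); set q := f (h *: u + x); set r := f (h *: v
  + x).
set s := f x; move=> e0 h2 h1.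
have : `|h * (h * a) - h * (h * b)| <= h * (h * (`|a - b| / 3)) + h * (h * (`|a
  - b| / 3)).
  apply: le_trans (lerD h1 h2); apply: le_trans (ler_normB _ _).
  rewrite le_eqVlt; apply/orP; left; apply/eqP; congr `|_|; ring.
rewrite -!mulrBr !normrM (gtr0_norm h0) -!mulrDr !ler_pM2l//; move: e0; lra.
Qed.

(** * Two families of pairwise meeting lines *)

Section Incidence.
Context (K : fieldType) (vT : vectType K).
Implicit Types U W Z : {vspace vT}.

Definition meet U W := (U :&: W != 0)%VS.

Lemma meet_dim U W Z : (U <= Z)%VS -> (W <= Z)%VS ->
  (\dim Z < \dim U + \dim W)%N -> meet U W.
Proof.
move=> UZ WZ; rewrite /meet -dimv_eq0 -lt0n.
have := dimv_sum_cap U W; have : (U + W <= Z)%VS by rewrite subv_add UZ.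
move=> /dimvS; move: (\dim _) (\dim _) (\dim _) (\dim _) (\dim _); lia.
Qed.

(** Projectively, [U] is a line joining a point of [L1] to a different point of [L2]. *)
Lemma vspace2_sub U L1 L2 Z : \dim U = 2%N -> meet U L1 -> meet U L2 ->
  (U :&: L1 :&: L2 = 0)%VS -> (L1 <= Z)%VS -> (L2 <= Z)%VS -> (U <= Z)%VS.
Proof.
rewrite /meet -!dimv_eq0 -!lt0n => dU d1 d2 U12 L1Z L2Z.
have /dimv_disjoint_sum dS : (U :&: L1 :&: (U :&: L2) = 0)%VS.
  by rewrite capvA -(capvA U) (capvC L1) capvA capvv.
have sU : (U :&: L1 + U :&: L2 <= U)%VS by rewrite subv_add !capvSl.
have sZ : (U :&: L1 + U :&: L2 <= Z)%VS.
  by rewrite subv_add (subv_trans (capvSr _ _) L1Z) (subv_trans (capvSr _ _)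
    L2Z).
suff /eqP <- : (U :&: L1 + U :&: L2 == U)%VS by [].
by rewrite -(dimv_leqif_eq sU) eqn_leq (dimvS sU) dU dS; lia.
Qed.

(** Two of the lines span a plane and meet in one point [v]; a third line avoiding [v] lies in that
    plane. A line [U] meeting all three has two different points in the plane, whether or not it
    passes through [v]. As [U] is arbitrary, the plane also contains the members of the other
    family. *)
Lemma meeting_lines_planar (I : Type) (E : I -> {vspace vT}) :
  (forall i, \dim (E i) = 2%N) -> (forall i i', meet (E i) (E i')) ->
  (forall v, v != 0 -> exists i, v \notin E i) -> inhabited I ->
  exists2 P : {vspace vT}, (\dim P <= 3)%N &
    forall U, \dim U = 2%N -> (forall i, meet U (E i)) -> (U <= P)%VS.
Proof.
move=> dE mE noc [i0].
have nz0 : vpick (E i0) != 0 by rewrite vpick0 -dimv_eq0 dE.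
have [i1 vi1] := noc _ nz0.
have E01 : E i0 != E i1.
  by apply: contra vi1 => /eqP <-; exact: memv_pick.
set L := (E i0 :&: E i1)%VS.
have dL : \dim L = 1%N.
  have : (\dim L <= \dim (E i0))%N by rewrite dimvS// capvSl.
  have : (0 < \dim L)%N by rewrite lt0n dimv_eq0; exact: mE.
  have : \dim L != 2%N.
    apply: contra E01 => /eqP dL2; have := dimv_leqif_eq (capvSl (E i0) (E i1)).
    move=> [_]; rewrite -/L dL2 dE eqxx => /esym/eqP L0.
    have := dimv_leqif_eq (capvSr (E i0) (E i1)).
    by move=> [_]; rewrite -/L dL2 dE eqxx L0 => /esym.
  by rewrite dE; move: (\dim L) => k; lia.
pose v := vpick L; have v0 : v != 0 by rewrite vpick0 -dimv_eq0 dL.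
have LE : L = <[v]>%VS.
  apply/esym/eqP; rewrite -(dimv_leqif_eq _) ?dL ?dim_vline ?v0//.
  by rewrite -memvE memv_pick.
have meetL U : meet U L -> v \in U.
  rewrite /meet -vpick0; set u := vpick _ => u0.
  have := memv_pick (U :&: L)%VS; rewrite memv_cap -/u LE => /andP[uU /vlineP[c
    uE]].
  have c0 : c != 0 by apply: contra u0; rewrite uE => /eqP ->; rewrite scale0r.
  by rewrite -(scalerK c0 v) -uE memvZ.
have [i2 vi2] := noc _ v0.
pose P := (E i0 + E i1)%VS.
have cap2 : (L :&: E i2 = 0)%VS.
  by apply/eqP; rewrite capvC; apply/negPn/negP => /meetL; apply/negP.
have E2P : (E i2 <= P)%VS.
  apply: (@vspace2_sub _ (E i0) (E i1)); rewrite ?dE ?addvSl ?addvSr//.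
  by rewrite -capvA capvC.
exists P.
  have := dimv_sum_cap (E i0) (E i1); rewrite !dE -/L -/P dL.
  by move: (\dim P) => k; lia.
move=> U dU mU; have [mL|mL] := boolP (meet U L).
  apply: (@vspace2_sub _ L (E i2)) => //.
    by rewrite -capvA cap2 capv0.
  by rewrite (subv_trans (capvSl _ _)) ?addvSl.
apply: (@vspace2_sub _ (E i0) (E i1)); rewrite ?addvSl ?addvSr//.
by rewrite -capvA; apply/eqP; move: mL; rewrite negbK.
Qed.

(** A line meeting two skew lines meets them in different points. It cannot equal [E i], because it
    meets [E i']. *)
Lemma disjoint_lines_span (I J : Type) (E : I -> {vspace vT})
    (F : J -> {vspace vT}) i i' :
  (forall j, \dim (F j) = 2%N) -> (forall i j, meet (F j) (E i)) ->
  ~ meet (E i) (E i') -> forall j, (F j <= E i + E i')%VS /\ E i != F j.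
Proof.
move=> dF mF /negP; rewrite negbK => /eqP E0 j; split.
  apply: (@vspace2_sub _ (E i) (E i')); rewrite ?addvSl ?addvSr//.
  by rewrite -capvA E0 capv0.
by apply/eqP => EF; have := mF i' j; rewrite -EF /meet E0 eqxx.
Qed.

(** The cases are a common point, a regulus and a planar configuration. The plane [g j i] is known
    to be the join of [E i] and [F j] only where these lines differ, which is why the last two cases
    control only some of the [g j i]. *)
Lemma incidence (I J : Type) (E : I -> {vspace vT}) (F : J -> {vspace vT})
    (g : J -> I -> {vspace vT}) :
  inhabited I -> inhabited J ->
  (forall i, \dim (E i) = 2%N) -> (forall j, \dim (F j) = 2%N) ->
  (forall j i, \dim (g j i) = 3%N) ->
  (forall j i, (E i <= g j i)%VS) -> (forall j i, (F j <= g j i)%VS) ->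
  [\/ exists2 q, q != 0 & forall j i, q \in g j i,
      exists (Z : {vspace vT}) i j, [/\ (\dim Z <= 4)%N,
        forall j', (g j' i <= Z)%VS & forall i', (g j i' <= Z)%VS]
    | exists (P : {vspace vT}) i i', (\dim P <= 3)%N /\
        forall j, (g j i <= P)%VS \/ (g j i' <= P)%VS].
Proof.
move=> I0 J0 dE dF dg Eg Fg.
have mFE i j : meet (F j) (E i) by apply: (meet_dim (Fg j i) (Eg j i)); rewrite
  dE dF dg.
have mEF j i : meet (E i) (F j) by rewrite /meet capvC; exact: mFE.
have gE j i : E i != F j -> g j i = (E i + F j)%VS.
  move=> EF; apply/esym/eqP; have S : (E i + F j <= g j i)%VS by rewrite
    subv_add Eg Fg.
  rewrite -(dimv_leqif_eq S) dg eqn_leq -{1}(dg j i) dimvS//=.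
  have := dimv_sum_cap (E i) (F j); rewrite dE dF.
  have : (\dim (E i :&: F j) <= \dim (E i))%N by rewrite dimvS// capvSl.
  have : \dim (E i :&: F j) != 2%N.
    apply: contra EF => /eqP d2; have := dimv_leqif_eq (capvSl (E i) (F j)).
    move=> [_]; rewrite d2 dE eqxx => /esym/eqP L0.
    have := dimv_leqif_eq (capvSr (E i) (F j)).
    by move=> [_]; rewrite d2 dF eqxx L0 => /esym.
  by rewrite dE; move: (\dim _) (\dim _) => k l; lia.
have [cE|ncE] := EM (exists2 v, v != 0 & forall i, v \in E i).
  case: cE => q q0 qE; apply: Or31; exists q => // j i.
  exact: (subvP (Eg j i)).
have [cF|ncF] := EM (exists2 v, v != 0 & forall j, v \in F j).
  case: cF => q q0 qF; apply: Or31; exists q => // j i.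
  exact: (subvP (Fg j i)).
have noE v : v != 0 -> exists i, v \notin E i.
  move=> v0; apply: contrapT => H; apply: ncE; exists v => // i.
  by apply/negPn/negP => vi; apply: H; exists i.
have noF v : v != 0 -> exists i, v \notin F i.
  move=> v0; apply: contrapT => H; apply: ncF; exists v => // i.
  by apply/negPn/negP => vi; apply: H; exists i.
have planar P : (\dim P <= 3)%N -> (forall i, (E i <= P)%VS) ->
    (forall j, (F j <= P)%VS) -> exists (P : {vspace vT}) i i', (\dim P <= 3)%N
      /\
        forall j, (g j i <= P)%VS \/ (g j i' <= P)%VS.
  move=> dP EP FP; have [i0] := I0.
  (* With two different lines [E i0] and [E i1], each [F j] differs from at least one of them, and
     the join with that one lies in [P]. *)
  have [i1 vi1] : exists i, vpick (E i0) \notin E i by apply: noE; rewrite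
    vpick0 -dimv_eq0 dE.
  exists P, i0, i1; split=> // j; have [E0|E0] := eqVneq (E i0) (F j).
    right; rewrite gE ?subv_add ?EP ?FP// -E0.
    by apply: contra vi1 => /eqP ->; exact: memv_pick.
  by left; rewrite gE// subv_add EP FP.
have [mE|] := EM (forall i i', meet (E i) (E i')).
  have [P dP sP] := meeting_lines_planar dE mE noE I0.
  by apply/Or33/(planar P) => // [i|j]; apply: sP.
have [mF|] := EM (forall j j', meet (F j) (F j')).
  have [P dP sP] := meeting_lines_planar dF mF noF J0.
  by move=> _; apply/Or33/(planar P) => // [i|j]; apply: sP.
move=> /existsNP[j /existsNP[j' nF]] /existsNP[i /existsNP[i' nE]].
have FZ := disjoint_lines_span dF mFE nE.
have EW := disjoint_lines_span dE mEF nF.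
have WZ : (F j + F j' <= E i + E i')%VS by rewrite subv_add !(proj1 (FZ _)).
(* Both families contain a skew pair. All lines lie in the span of the first pair, and the members
   [i] and [j] of the skew pairs differ from every line of the other family, so the joins along this
   cross are determined. *)
apply: Or32; exists (E i + E i')%VS, i, j; split.
- by have := dimv_add_leqif (E i) (E i'); rewrite !dE => -[].
- by move=> k; have [FkZ EFk] := FZ k; rewrite gE// subv_add addvSl.
move=> k; have [EkW FEk] := EW k.
by rewrite gE 1?eq_sym// subv_add (subv_trans EkW WZ) (proj1 (FZ _)).
Qed.

End Incidence.

Lemma ord3_cover (i j k l : 'I_3) : i != j -> i != k -> j != k ->
  [\/ l = i, l = j | l = k].
Proof.
move=> ij ik jk; have [->|li] := eqVneq l i; first exact: Or31.
have [->|lj] := eqVneq l j; first exact: Or32.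
apply: Or33; apply/val_inj.
move: i j k l ij ik jk li lj.
do 4 ! (move=> [[|[|[|?]]] ?] //=).
Qed.

Lemma third_index (k i : 'I_3) : i != k -> exists j, (i != j) && (j != k).
Proof.
move=> ik; have : (0 < #|~: [set i; k]|)%N.
  by rewrite cardsCs finset.setCK card_ord cards2 ik.
by case/card_gt0P => j; rewrite !inE negb_or eq_sym => H; exists j.
Qed.

Lemma other_indices (k : 'I_3) : exists i j, [&& i != k, j != k & i != j].
Proof.
have [i ik] : exists i : 'I_3, i != k.
  by case: k => [[|k] hk]; [exists 1|exists 0].
by have [j /andP[ij jk]] := third_index ik; exists i, j; rewrite ik jk ij.
Qed.

Lemma free_mask (K : fieldType) (vT : vectType K) (b : bitseq) (X : seq vT) :
  free X -> free (mask b X).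
Proof.
elim: X b => [|x X IH] [|[] b] //=; rewrite ?nil_free// free_cons => /andP[xX
  fX].
  rewrite free_cons IH// andbT; apply: contra xX; apply/subvP/sub_span.
  by move=> y; exact: mem_mask.
exact: IH.
Qed.

Lemma free_size_dim (K : fieldType) (vT : vectType K) (X : seq vT)
    (P : {vspace vT}) : free X -> {subset X <= P} -> (size X <= \dim P)%N.
Proof. by rewrite /free => /eqP <- /span_subvP/dimvS. Qed.

(** * Frames of R^(4,2) adapted to a point *)

Section Frame.
Context (R : realType) (G : 'M[R]_6).
Local Notation V := 'rV[R]_6.
Local Notation B := (lie_form G).
Context (geoG : lie_geometry G).
Context (p m z : V) (t : 'I_3 -> V).
Context (pp : B p p = -1) (mm : B m m = 0) (mp : B m p = 0) (zm : B z m != 0).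
Context (tm : forall l, B (t l) m = 0) (tp : forall l, B (t l) p = 0).
Context (tt0 : forall l l', l != l' -> B (t l) (t l') = 0).
Context (tt : forall l, 0 < B (t l) (t l)).

(** In this order each vector is separated from the later ones by a pairing: [z] by [m], the [t l]
    and [p] by themselves, and finally [m] by [z]. *)
Lemma frame_free i j k : i != j -> i != k -> j != k ->
  free [:: z; t i; t j; t k; p; m].
Proof.
move=> ij ik jk; have lC := lieC geoG.
have sep (x : V) (X : seq V) : all (fun y => B x y == 0) X ->
    {in X, forall y, B x y = 0}.
  by move=> /allP H y /H /eqP.
have tn l : B (t l) (t l) != 0 by rewrite gt_eqF.
apply: (@free_cons_sep _ G _ _ m); rewrite 1?lC//.
  by apply: sep => /=; rewrite !(lC m) !tm (lC p) mp mm !eqxx.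
apply: (@free_cons_sep _ G _ _ (t i)); rewrite ?tn//.
  by apply: sep => /=; rewrite !tt0// tp tm !eqxx.
apply: (@free_cons_sep _ G _ _ (t j)); rewrite ?tn//.
  by apply: sep => /=; rewrite !tt0// tp tm !eqxx.
apply: (@free_cons_sep _ G _ _ (t k)); rewrite ?tn//.
  by apply: sep => /=; rewrite tp tm !eqxx.
apply: (@free_cons_sep _ G _ _ p); rewrite ?pp ?oppr_eq0 ?oner_eq0//.
  by apply: sep => /=; rewrite lC mp eqxx.
apply: (@free_cons_sep _ G _ _ z) => //.
exact: nil_free.
Qed.

Lemma frame_perp v : B v m = 0 -> B v p = 0 -> B v z = 0 ->
  (forall l, B v (t l) = 0) -> v = 0.
Proof.
move=> vm vp vz vt.
apply: (perp_full geoG (@frame_free 0 1 2%:R _ _ _)) => // x.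
by rewrite !inE => /or4P[/eqP->|/eqP->|/eqP->|/or3P[]/eqP->].
Qed.

End Frame.

(** * Systems with circular trajectories *)

Lemma box_upd (R : realType) (n : nat) (a b x : 'rV[R]_n.+1) k s :
  box a b x -> a 0 k < s < b 0 k -> box a b (upd x k s).
Proof. by move=> xX sab l; rewrite mxE; case: eqP => [->|_]. Qed.

Lemma near_itv_oo (R : realType) (a b s : R) : a < s < b ->
  \forall t \near s, a < t < b.
Proof.
move=> sab; have /near_in_itvoo : s \in `]a, b[ by rewrite in_itv.
by apply: filterS => t; rewrite in_itv.
Qed.

Lemma open_box (R : realType) (n : nat) (a b : 'rV[R]_n.+1) : open (box a b).
Proof.
rewrite openE => x xX.
suff : \forall y \near x, (forall i, a 0 i < (y : 'rV[R]_n.+1) 0 i < b 0 i) by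
  [].
apply: (@filter_forall _ _ (fun i (y : 'rV[R]_n.+1) => a 0 i < y 0 i < b 0 i)
  (nbhs x)) => i.
exact: (@coord_continuous _ _ _ 0 i x _ (near_itv_oo (xX i))).
Qed.

#[local] Opaque lie_form.

Section Core.
Context (R : realType) (G : 'M[R]_6).
Local Notation V := 'rV[R]_6.
Local Notation B := (lie_form G).
Context (geoG : lie_geometry G) (p : V) (pp : B p p = -1).
Context (a b : 'rV[R]_3) (m : 'rV[R]_3 -> V).
Local Notation X := (box a b).

Context (d : 'I_3 -> 'rV[R]_3 -> V) (dd : 'I_3 -> 'I_3 -> 'rV[R]_3 -> V).
Context (der_m : forall i x, X x -> is_derive x (dir R i) m (d i x)).
Context (der_d : forall i j x, X x -> is_derive x (dir R i) (d j) (dd i j x)).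
Context (diff_d : forall i x, X x -> differentiable (d i) x).
Context (diff_dd : forall i j x, X x -> differentiable (dd i j) x).
Context (m_null : forall x, X x -> B (m x) (m x) = 0).
Context (m_p : forall x, X x -> B (m x) p = 0).
Context (m_orth : forall x i j, X x -> i != j -> B (d i x) (d j x) = 0).
Context (m_imm : forall x i, X x -> 0 < B (d i x) (d i x)).
Context (m_circ : forall x k, X x -> exists2 g : {vspace V}, \dim g = 3%N &
  forall s, a 0 k < s < b 0 k -> m (upd x k s) \in g).

Lemma derive_box0 (f : 'rV[R]_3 -> R) x v df :
  (forall y, X y -> f y = 0) -> X x -> is_derive x v f df -> df = 0.
Proof.
move=> f0 xX [_ <-]; rewrite (@near_eq_derive _ _ _ _ (cst 0)) ?derive_cst//.
by move: (open_box xX); apply: filterS => y /f0.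
Qed.

Let lC := lieC geoG.

(** * Differentiated identities and Dupin's theorem *)

Lemma d_m x i : X x -> B (d i x) (m x) = 0.
Proof.
move=> xX; have := derive_box0 m_null xX (is_derive_lie G (der_m i xX) (der_m i
  xX)).
rewrite (lC (m x)); lra.
Qed.

Lemma d_p x i : X x -> B (d i x) p = 0.
Proof.
move=> xX; have := derive_box0 m_p xX (is_derive_lie G (der_m i xX)
  (is_derive_cst p _ _)).
by rewrite lie0r addr0.
Qed.

Lemma dd_p x i j : X x -> B (dd i j x) p = 0.
Proof.
move=> xX; have := derive_box0 (fun y => @d_p y j) xX
  (is_derive_lie G (der_d i j xX) (is_derive_cst p _ _)).
by rewrite lie0r addr0.
Qed.

Lemma dd_m x i j : X x -> B (dd i j x) (m x) = - B (d j x) (d i x).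
Proof.
move=> xX; have := derive_box0 (fun y => @d_m y j) xX
  (is_derive_lie G (der_d i j xX) (der_m i xX)).
by move/eqP; rewrite addr_eq0 => /eqP.
Qed.

Lemma dd_d x i j k : X x -> i != j ->
  B (dd k i x) (d j x) = - B (dd k j x) (d i x).
Proof.
move=> xX ij; have := derive_box0 (fun y yX => @m_orth y i j yX ij) xX
  (is_derive_lie G (der_d k i xX) (der_d k j xX)).
by rewrite (lC (d i x)) => /eqP; rewrite addr_eq0 => /eqP.
Qed.

Lemma ddC x i j : X x -> dd i j x = dd j i x.
Proof.
move=> xX; apply/rowP => l.
have nX : \forall y \near x, X y by exact: open_box xX.
have E k : \forall y \near x,
    is_derive y (dir R k) (fun y => m y 0 l) (d k y 0 l).
  apply: filterS nX => y yX; have [dm <-] := der_m k yX.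
  apply: DeriveDef; first by have /derivable_mxP := dm; exact.
  by rewrite derive_mx// mxE.
have dc k : differentiable (fun y => d k y 0 l) x.
  apply: (differentiable_comp (g := fun v : V => v 0 l)); first exact: diff_d.
  exact: differentiable_coord.
have ddl i' j' : dd i' j' x 0 l = 'D_(dir R i') (fun y => d j' y 0 l) x.
  by have [dj <-] := der_d i' j' xX; rewrite derive_mx// mxE.
by rewrite !ddl; exact: derive_sym (E i) (E j) (dc i) (dc j).
Qed.

(** Differentiating the three orthogonality relations shows, by symmetry of [dd], that the three
    products of a mixed second derivative with the remaining tangent are pairwise opposite. Hence
    all of them vanish. *)
Lemma dupin_orthogonality x i j k : X x -> i != j -> i != k -> j != k ->
  B (dd i j x) (d k x) = 0.
Proof.
move=> xX ij ik jk.
have h1 := dd_d k xX ij; have h2 := dd_d j xX ik; have h3 := dd_d i xX jk.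
rewrite (ddC k j xX) (ddC k i xX) in h1; rewrite (ddC j i xX) in h2.
lra.
Qed.

Lemma dd_m_neq0 x k : X x -> B (dd k k x) (m x) != 0.
Proof. by move=> xX; rewrite dd_m// oppr_eq0 gt_eqF// m_imm. Qed.

Lemma frame_at_free x i j k l : X x -> i != j -> i != k -> j != k ->
  free [:: dd l l x; d i x; d j x; d k x; p; m x].
Proof.
move=> xX ij ik jk; apply: (@frame_free _ G geoG p (m x) _ (d^~ x)) => //;
  [exact: m_null|exact: m_p|exact: dd_m_neq0|..] => *;
  [exact: d_m|exact: d_p|exact: m_orth|exact: m_imm].
Qed.

Lemma frame_at_perp x l v : X x -> B v (m x) = 0 -> B v p = 0 ->
  B v (dd l l x) = 0 -> (forall i, B v (d i x) = 0) -> v = 0.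
Proof.
move=> xX vm vp vz vd.
apply: (@frame_perp _ G geoG p (m x) (dd l l x) (d^~ x)) => //;
  [exact: m_null|exact: m_p|exact: dd_m_neq0|..] => *;
  [exact: d_m|exact: d_p|exact: m_orth|exact: m_imm].
Qed.

(** * Lamé coefficients and curvature spheres *)

Definition speed i x := Num.sqrt (B (d i x) (d i x)).
Local Notation h := speed.

Lemma speed_gt0 i x : X x -> 0 < h i x.
Proof. by move=> xX; rewrite sqrtr_gt0 m_imm. Qed.

Lemma speed_neq0 i x : X x -> h i x != 0.
Proof. by move=> xX; rewrite gt_eqF// speed_gt0. Qed.

Lemma speedE i x : X x -> B (d i x) (d i x) = h i x ^+ 2.
Proof. by move=> xX; rewrite sqr_sqrtr// ltW// m_imm. Qed.

(* Curvature sphere of the surface [x_i = const] along its [k]-th curve, as a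
   unit vector of p^perp: the coefficient of [m] makes it orthogonal to
   gamma_k.  [locked] keeps the bilinearity rules from unfolding it. *)
Definition curvature_sphere := locked (fun k i x =>
  (h i x)^-1 *: (d i x + (B (d i x) (dd k k x) / h k x ^+ 2) *: m x) : V).
Local Notation S := curvature_sphere.

Lemma curvature_sphereE k i x : S k i x =
  (h i x)^-1 *: (d i x + (B (d i x) (dd k k x) / h k x ^+ 2) *: m x).
Proof. by rewrite /curvature_sphere -lock. Qed.

Lemma curvature_sphere_m k i x : X x -> B (S k i x) (m x) = 0.
Proof. by move=> xX; rewrite curvature_sphereE !lieE d_m// m_null//; ring. Qed.

Lemma curvature_sphere_p k i x : X x -> B (S k i x) p = 0.
Proof. by move=> xX; rewrite curvature_sphereE !lieE d_p// m_p//; ring. Qed.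

Lemma curvature_sphere_d k i j x : X x -> i != j -> B (S k i x) (d j x) = 0.
Proof. by move=> xX ij; rewrite curvature_sphereE !lieE m_orth// (lC (m x))
  d_m//; ring. Qed.

Lemma curvature_sphere_di k i x : X x -> B (S k i x) (d i x) = h i x.
Proof.
move=> xX; rewrite curvature_sphereE !lieE speedE// (lC (m x)) d_m//; field.
by rewrite !speed_neq0.
Qed.

Lemma curvature_sphere_dd k i x : X x -> B (S k i x) (dd k k x) = 0.
Proof.
move=> xX; rewrite curvature_sphereE !lieE (lC (m x)) dd_m// speedE//; field.
by rewrite !speed_neq0.
Qed.

Lemma curvature_sphere_orth k i k' j x : X x -> i != j -> B (S k i x) (S k' j
  x) = 0.
Proof.
move=> xX ij; rewrite [X in B _ X]curvature_sphereE lieZr lieDr lieZr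
  curvature_sphere_d// curvature_sphere_m//; ring.
Qed.

Lemma curvature_sphere_unique x k i w : X x -> i != k -> B w (m x) = 0 -> B w p
  = 0 ->
  B w (dd k k x) = 0 -> B w (d i x) = h i x ->
  (forall j, j != i -> B w (d j x) = 0) -> w = S k i x.
Proof.
move=> xX ik wm wp wz wi wj; apply/eqP; rewrite -subr_eq0; apply/eqP.
apply: (@frame_at_perp x k) => //; rewrite ?lieE ?wm ?curvature_sphere_m ?wp
  ?curvature_sphere_p ?wz ?curvature_sphere_dd ?subr0//.
move=> j; rewrite !lieE; have [->|ji] := eqVneq j i.
  by rewrite wi curvature_sphere_di// subrr.
by rewrite wj// curvature_sphere_d 1?eq_sym// subrr.
Qed.

(** * The spaces of the circles *)

Definition circle_space k x : {vspace V} := <<[:: dd k k x; d k x; m x]>>%VS.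
Local Notation g := circle_space.

Lemma circle_free k x : X x -> free [:: dd k k x; d k x; m x].
Proof.
move=> xX; have [i [j /and3P[ik jk ij]]] := other_indices k.
exact: (free_mask [:: true; false; false; true; false; true]
  (frame_at_free k xX ij ik jk)).
Qed.

Lemma dim_circle_space k x : X x -> \dim (g k x) = 3%N.
Proof. by move=> /(circle_free k); rewrite /free => /eqP. Qed.

Lemma mem_circle_space k x :
  [/\ dd k k x \in g k x, d k x \in g k x & m x \in g k x].
Proof. by split; apply: memv_span; rewrite !inE eqxx ?orbT. Qed.

Lemma mem_box x k : X x -> a 0 k < x 0 k < b 0 k.
Proof. exact. Qed.

(** A curve that stays in the linear space [P] has its first and second derivatives in [P]. *)
Lemma circle_space_sub (P : {vspace V}) k x : X x ->
  (\forall s \near x 0 k, m (upd x k s) \in P) -> (g k x <= P)%VS.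
Proof.
move=> xX mP; have itv := near_itv_oo (mem_box k xX).
have dP s : (\forall t \near s, m (upd x k t) \in P) -> X (upd x k s) ->
    d k (upd x k s) \in P.
  by move=> mPs sX; exact: (derive_memv mPs (is_derive_upd (der_m k sX))).
have dPn : \forall s \near x 0 k, d k (upd x k s) \in P.
  have /nbhs_interior mP' := mP.
  near=> s; apply: dP; first by near: s.
  by apply: box_upd => //; near: s.
apply/span_subvP => v; rewrite !inE => /or3P[] /eqP ->.
- have xX' : X (upd x k (x 0 k)) by rewrite upd_id.
  rewrite -(upd_id x k).
  exact: (derive_memv dPn (is_derive_upd (der_d k k xX'))).
- by have := nbhs_singleton dPn; rewrite upd_id.
- by have := nbhs_singleton mP; rewrite upd_id.
Unshelve. all: by end_near. Qed.

Lemma upd_same (x : 'rV[R]_3) k s : (upd x k s) 0 k = s.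
Proof. by rewrite mxE eqxx. Qed.

Lemma upd_other (x : 'rV[R]_3) k l s : l != k -> (upd x k s) 0 l = x 0 l.
Proof. by move=> lk; rewrite mxE (negPf lk). Qed.

(** The osculating space lies in the 3-space of the circle and has the same dimension, so the two
    coincide. *)
Lemma m_in_circle_space k x s : X x -> a 0 k < s < b 0 k -> m (upd x k s) \in g
  k x.
Proof.
move=> xX sab; have [c dc cP] := m_circ k xX.
suff /eqP -> : g k x == c by exact: cP.
have gc : (g k x <= c)%VS.
  apply: circle_space_sub => //.
  by apply: filterS (near_itv_oo (mem_box k xX)) => t /cP.
by rewrite -(dimv_leqif_eq gc) dim_circle_space// dc.
Qed.

(** The sphere is frozen at [x] while the point moves: orthogonality to gamma_k(x) means
    orthogonality to the whole circle. The next two lemmas differentiate this along the curve. *)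
Lemma curvature_sphere_line k i x s : X x -> i != k -> a 0 k < s < b 0 k ->
  B (S k i x) (m (upd x k s)) = 0.
Proof.
move=> xX ik sab; apply: (span_perp _ (m_in_circle_space xX sab)) => v.
rewrite !inE => /or3P[] /eqP ->; rewrite ?curvature_sphere_dd
  ?curvature_sphere_m//.
by rewrite curvature_sphere_d.
Qed.

Lemma derive_itv0 (f : R -> R) u v s df : (forall t, u < t < v -> f t = 0) ->
  u < s < v -> is_derive s 1 f df -> df = 0.
Proof.
move=> f0 sab [_ <-]; rewrite (@near_eq_derive _ _ _ _ (cst 0)) ?derive_cst//.
by apply: filterS (near_itv_oo sab) => t /f0.
Qed.

Lemma curvature_sphere_line_d k i x s : X x -> i != k -> a 0 k < s < b 0 k ->
  B (S k i x) (d k (upd x k s)) = 0.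
Proof.
move=> xX ik sab; have sX := box_upd xX sab.
have := is_derive_lie G (is_derive_cst (S k i x) s 1) (is_derive_upd (der_m k
  sX)).
move/(derive_itv0 (fun t => @curvature_sphere_line k i x t xX ik) sab).
by rewrite lie0l add0r.
Qed.

Lemma curvature_sphere_line_dd k i x s : X x -> i != k -> a 0 k < s < b 0 k ->
  B (S k i x) (dd k k (upd x k s)) = 0.
Proof.
move=> xX ik sab; have sX := box_upd xX sab.
have := is_derive_lie G (is_derive_cst (S k i x) s 1) (is_derive_upd (der_d k k
  sX)).
move/(derive_itv0 (fun t => @curvature_sphere_line_d k i x t xX ik) sab).
by rewrite lie0l add0r.
Qed.

(** Such a [w] is a combination of the two curvature spheres S_kl and S_kj, and by Dupin's theorem
    S_kj is orthogonal to [dd k l]. The equation states that <w, d_l m>/h_l has derivative 0 along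
    the k-th curve. *)
Lemma derive_perp_circle w y k l : X y -> l != k -> B w (m y) = 0 -> B w p = 0
  ->
  B w (d k y) = 0 -> B w (dd k k y) = 0 ->
  B w (dd k l y) * h l y ^+ 2 = B w (d l y) * B (dd k l y) (d l y).
Proof.
move=> yX lk wm wp wk wkk; have [j /andP[lj jk]] := third_index lk.
have h0 i := speed_neq0 i yX.
pose w' := (B w (d l y) / h l y) *: S k l y + (B w (d j y) / h j y) *: S k j y.
have -> : w = w'.
  apply/eqP; rewrite -subr_eq0; apply/eqP; apply: (frame_at_perp (l := k) yX).
  - by rewrite /w' !lieE wm !curvature_sphere_m//; ring.
  - by rewrite /w' !lieE wp !curvature_sphere_p//; ring.
  - by rewrite /w' !lieE wkk !curvature_sphere_dd//; ring.
  move=> i; have [->|->|->] := ord3_cover i lj lk jk.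
  - by rewrite /w' !lieE curvature_sphere_di// (@curvature_sphere_d k j l y yX)
    1?eq_sym//; field; rewrite ?h0.
  - by rewrite /w' !lieE curvature_sphere_di// (@curvature_sphere_d k l j y
    yX)//; field; rewrite ?h0.
  - by rewrite /w' !lieE wk !curvature_sphere_d//; ring.
rewrite /w' !curvature_sphereE !lieE !(lC (m y)) dd_m// !(lC (d _ y) (dd k l
  y)).
rewrite (@dupin_orthogonality y k l j)// 1?eq_sym// m_orth// 1?(@m_orth y j
  l)// 1?eq_sym//.
rewrite !d_m// !speedE//; field.
by rewrite !h0.
Qed.

Lemma curvature_sphere_const k i x s : X x -> i != k -> a 0 k < s < b 0 k ->
  S k i (upd x k s) = S k i x.
Proof.
move=> xX ik sab; apply/esym; have sX := box_upd xX sab.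
set w := S k i x.
(* These quotients are the cosines of the angles that the fixed sphere [w] makes with the surfaces;
   being constant, they identify [w] with the curvature sphere at the moved point. *)
have cst l : l != k -> B w (d l (upd x k s)) / h l (upd x k s) =
    B w (d l x) / h l x.
  move=> lk; pose f t := B w (d l (upd x k t)) / h l (upd x k t).
  rewrite -/(f s) -[in RHS](upd_id x k) -/(f (x 0 k)).
  apply: (@itv_const R f (a 0 k) (b 0 k) _ s (x 0 k) sab (mem_box k xX)) => t
    tab.
  have tX := box_upd xX tab; set y := upd x k t in tX.
  have num := is_derive_lie G (is_derive_cst w t 1) (is_derive_upd (der_d k l
    tX)).
  rewrite lie0l add0r -/y in num.
  have den := is_derive_lie G (is_derive_upd (der_d k l tX)) (is_derive_upd
    (der_d k l tX)).
  rewrite -/y in den.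
  have hd : is_derive t 1 (fun t => h l (upd x k t))
      ((2 * h l y)^-1 * (B (dd k l y) (d l y) + B (d l y) (dd k l y))).
    exact: (is_derive1_comp (is_derive1_sqrt (m_imm l tX)) den).
  have hV := @is_deriveV R (fun t => h l (upd x k t)) t _ 1 (speed_neq0 l tX)
    hd.
  have E := derive_perp_circle tX lk (curvature_sphere_line xX ik tab)
    (curvature_sphere_p k i xX) (curvature_sphere_line_d xX ik tab)
    (curvature_sphere_line_dd xX ik tab).
  apply: is_derive_eq (is_deriveM num hV) _.
  rewrite -/w in E; rewrite /cst -/y; have hn := speed_neq0 l tX.
  have -> : B w (dd k l y) = B w (d l y) * B (dd k l y) (d l y) / h l y ^+ 2.
    by rewrite -E mulfK// expf_neq0.
  by rewrite /GRing.scale/= (lC (d l y)); field.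
apply: (curvature_sphere_unique sX ik); rewrite ?curvature_sphere_line
  ?curvature_sphere_p ?curvature_sphere_line_dd//.
  have := cst i ik; rewrite curvature_sphere_di// divff ?speed_neq0// =>
    /(canRL (divfK _)).
  by rewrite mul1r; apply; exact: speed_neq0.
move=> j ji; have [->|jk] := eqVneq j k; first exact: curvature_sphere_line_d.
have := cst j jk; rewrite curvature_sphere_d 1?eq_sym// mul0r => /eqP.
by rewrite mulf_eq0 invr_eq0 (negPf (speed_neq0 j sX)) orbF => /eqP.
Qed.

(** This describes gamma_k as the orthogonal complement of [p] and the two curvature spheres S_ki,
    so that constancy of these spheres passes to gamma_k. *)
Lemma circle_spaceP k x v : X x ->
  reflect (B v p = 0 /\ forall i, i != k -> B v (S k i x) = 0) (v \in g k x).
Proof.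
move=> xX; apply: (iffP idP) => [vg|[vp vS]].
  split; [|move=> i ik]; rewrite lC; apply: (span_perp _ vg) => u;
    rewrite !inE => /or3P[] /eqP ->; rewrite ?curvature_sphere_dd
      ?curvature_sphere_m ?curvature_sphere_d// lC;
    [exact: dd_p|exact: d_p|exact: m_p].
have [i [j /and3P[ik jk ij]]] := other_indices k.
have hk := speed_neq0 k xX; have [ddg dg mg] := mem_circle_space k x.
(* The coefficients [c], [e] and [f] remove in turn the products with [m], [d k] and [dd k k]; what
   is left is orthogonal to the whole frame. *)
pose c := - B v (m x) / h k x ^+ 2.
pose u := v - c *: dd k k x.
pose e := B u (d k x) / h k x ^+ 2.
pose u' := u - e *: d k x.
pose f := - B u' (dd k k x) / h k x ^+ 2.
have u'm : B u' (m x) = 0.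
  by rewrite /u' /u /c !lieE d_m// dd_m// speedE//; field.
suff : u' - f *: m x = 0.
  move=> /eqP; rewrite subr_eq0 => /eqP u'E.
  have -> : v = f *: m x + e *: d k x + c *: dd k k x by rewrite -u'E !subrK.
  by rewrite !memvD// memvZ.
have uS l : l != k -> B (u' - f *: m x) (S k l x) = 0.
  move=> lk; rewrite /u' /u !lieDl !lieNl !lieZl vS// !(lC _ (S k l x)).
  by rewrite curvature_sphere_dd// curvature_sphere_d// curvature_sphere_m//;
    ring.
have um : B (u' - f *: m x) (m x) = 0.
  by rewrite lieDl lieNl lieZl u'm m_null//; ring.
apply: (@frame_at_perp x k) => //.
- by rewrite /u' /u !lieE vp d_p// m_p// dd_p//; ring.
- rewrite lieDl lieNl lieZl (lC (m x)) dd_m// speedE// /f; field.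
  by [].
move=> l; have [->|lk] := eqVneq l k.
  rewrite lieDl lieNl lieZl (lC (m x)) d_m// /u' lieDl lieNl lieZl speedE// /e.
  by field.
have := uS l lk; rewrite curvature_sphereE lieZr lieDr lieZr um mulr0 addr0.
by move=> /eqP; rewrite mulf_eq0 invr_eq0 (negPf (speed_neq0 l xX)) => /eqP.
Qed.

Lemma circle_space_const k x s : X x -> a 0 k < s < b 0 k ->
  g k (upd x k s) = g k x.
Proof.
move=> xX sab; have sX := box_upd xX sab.
apply/vspaceP => v; apply/(circle_spaceP _ _ sX)/(circle_spaceP _ _ xX).
  by move=> [vp vS]; split=> // i ik; rewrite -(curvature_sphere_const xX ik
    sab) vS.
by move=> [vp vS]; split=> // i ik; rewrite (curvature_sphere_const xX ik sab)
  vS.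
Qed.

(** On the surface x_j = const, the i-th curve through [x] crosses the k-th curve through [y]. S_ik
    is constant along the former, gamma_k along the latter, and at the crossing S_ik is orthogonal
    to [p] and to all S_kl with l != k. *)
Lemma curvature_sphere_in_circle_space i j k x y : X x -> X y ->
  i != j -> i != k -> j != k -> x 0 j = y 0 j -> S i k x \in g k y.
Proof.
move=> xX yX ij ik jk xyj.
have E : upd x i (y 0 i) = upd y k (x 0 k).
  apply/rowP => l; rewrite !mxE.
  have [->|->|->] := ord3_cover l ij ik jk; rewrite ?eqxx ?(negPf ik) //.
    by rewrite eq_sym (negPf ij) (negPf jk).
  by rewrite eq_sym (negPf ik).
have ki : k != i by rewrite eq_sym.
rewrite -(curvature_sphere_const xX ki (mem_box i yX)) E.
rewrite -(circle_space_const yX (mem_box k xX)).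
have y1X := box_upd yX (mem_box k xX).
apply/(circle_spaceP _ _ y1X); split; first exact: curvature_sphere_p.
by move=> l lk; apply: curvature_sphere_orth; rewrite 1?eq_sym.
Qed.

(** Two non-proportional S_ik along the k-th curve through [x] span [E]. If all were proportional to
    S_ik(x), this sphere would be orthogonal to [m] along the curve, and differentiating would
    contradict <S_ik, d_k m> = h_k > 0. *)
Lemma circle_spaces_common_line i j k x : X x -> i != j -> i != k -> j != k ->
  exists2 E : {vspace V}, \dim E = 2%N &
    forall y, X y -> y 0 j = x 0 j -> (E <= g k y)%VS.
Proof.
move=> xX ij ik jk.
have S0 : S i k x != 0.
  apply: contraTneq (speed_gt0 k xX) => S0.
  by rewrite -(curvature_sphere_di i k xX) S0 lie0l ltxx.
have [[s [sab sS]]|H] := EM (exists s, a 0 k < s < b 0 k /\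
    S i k (upd x k s) \notin <[S i k x]>%VS).
  have sX := box_upd xX sab.
  exists <<[:: S i k (upd x k s); S i k x]>>%VS.
    suff : free [:: S i k (upd x k s); S i k x] by rewrite /free => /eqP.
    by rewrite free_cons span_seq1 sS seq1_free.
  move=> y yX yx; apply/span_subvP => v; rewrite !inE => /orP[] /eqP ->;
    apply: (curvature_sphere_in_circle_space (j := j)) => //.
  by rewrite upd_other.
have Sm s : a 0 k < s < b 0 k -> B (S i k x) (m (upd x k s)) = 0.
  move=> sab; have sX := box_upd xX sab.
  have : S i k (upd x k s) \in <[S i k x]>%VS.
    by apply/negPn/negP => nS; apply: H; exists s.
  move=> /vlineP[c cE]; have := curvature_sphere_m i k sX; rewrite cE lieZl =>
    /eqP.
  rewrite mulf_eq0 => /orP[/eqP c0|/eqP//].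
  have := speed_gt0 k sX; rewrite -(curvature_sphere_di i k sX) cE c0 scale0r
    lie0l ltxx//.
have xX' : X (upd x k (x 0 k)) by rewrite upd_id.
have := is_derive_lie G (is_derive_cst (S i k x) _ _) (is_derive_upd (der_m k
  xX')).
move/(derive_itv0 Sm (mem_box k xX)); rewrite lie0l add0r /cst upd_id
  curvature_sphere_di//.
by move/eqP; rewrite (negPf (speed_neq0 k xX)).
Qed.

Lemma circle_space_sub_dim4 i k x (P : {vspace V}) : X x -> i != k ->
  (g k x <= P)%VS -> (g i x <= P)%VS -> (4 <= \dim P)%N.
Proof.
move=> xX ik gk gi; have [j /andP[ij jk]] := third_index ik.
have F := free_mask [:: true; true; false; true; false; true]
  (frame_at_free k xX ij ik jk).
apply: (free_size_dim F) => v; rewrite /= !inE.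
have [ddk dk mk] := mem_circle_space k x; have [_ di _] := mem_circle_space i x.
by case/or4P => /eqP ->; [exact: (subvP gk)|exact: (subvP gi)|
  exact: (subvP gk)|exact: (subvP gk)].
Qed.

Lemma circle_space_sub_dim5 i j k x (P : {vspace V}) : X x ->
  i != j -> i != k -> j != k ->
  (g k x <= P)%VS -> (g i x <= P)%VS -> (g j x <= P)%VS -> (5 <= \dim P)%N.
Proof.
move=> xX ij ik jk gk gi gj.
have F := free_mask [:: true; true; true; true; false; true]
  (frame_at_free k xX ij ik jk).
apply: (free_size_dim F) => v; rewrite /= !inE.
have [ddk dk mk] := mem_circle_space k x; have [_ di _] := mem_circle_space i x.
have [_ dj _] := mem_circle_space j x.
by case/or4P => [/eqP ->|/eqP ->|/eqP ->|/orP[]/eqP ->];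
  [exact: (subvP gk)|exact: (subvP gi)|exact: (subvP gj)|
  exact: (subvP gk)|exact: (subvP gk)].
Qed.

(** One of the three generators lies outside [P]; a functional that separates it from [P] stays
    nonzero nearby by continuity. *)
Lemma circle_space_notin_near k i x (P : {vspace V}) : X x ->
  ~~ (g k x <= P)%VS ->
  \forall s \near x 0 i, ~~ (g k (upd x i s) <= P)%VS.
Proof.
move=> xX gP.
have itv := near_itv_oo (mem_box i xX).
have H (f : 'rV[R]_3 -> V) : (forall y, X y -> f y \in g k y) ->
    derivable f x (dir R i) -> f x \notin P ->
    \forall s \near x 0 i, ~~ (g k (upd x i s) <= P)%VS.
  move=> fg fd /sep_vspace[w [Pw fw]].
  have fd' : is_derive (upd x i (x 0 i)) (dir R i) f ('D_(dir R i) f x).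
    by rewrite upd_id; exact: DeriveDef.
  have [D _] := is_derive_lie 1%:M (is_derive_upd fd') (is_derive_cst w _ _).
  have C : {for x 0 i, continuous (fun s => lie_form 1%:M (f (upd x i s)) w)}.
    exact/differentiable_continuous/derivable1_diffP.
  have : \forall s \near x 0 i, lie_form 1%:M (f (upd x i s)) w != 0.
    have := cvgr_neq0 _ C; rewrite upd_id; exact.
  move=> nz; near=> s; apply/negP => gsP.
  have : lie_form 1%:M (f (upd x i s)) w != 0 by near: s.
  rewrite Pw ?eqxx//; apply: (subvP gsP); apply: fg; apply: box_upd => //.
  by near: s.
have : exists2 v, v \in [:: dd k k x; d k x; m x] & v \notin P.
  apply: contrapT => nE; move/negP : gP; apply; apply/span_subvP => v vg.
  by apply/negPn/negP => vP; apply: nE; exists v.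
move=> [v]; rewrite !inE => /or3P[] /eqP ->; apply: H.
- by move=> y yX; have [] := mem_circle_space k y.
- exact/diff_derivable/diff_dd.
- by move=> y yX; have [] := mem_circle_space k y.
- exact/diff_derivable/diff_d.
- by move=> y yX; have [] := mem_circle_space k y.
- by have [] := der_m i xX.
Unshelve. all: by end_near. Qed.

Lemma common_circle_vector k x0 : X x0 ->
  exists2 q, q != 0 & forall x, X x -> q \in g k x.
Proof.
move=> x0X; have [i [j /and3P[ik jk ij]]] := other_indices k.
have ji : j != i by rewrite eq_sym.
(* The k-th circles are indexed by the values [e] of x_i and [c] of x_j; the line [E] will depend on
   [c] only and the line [F] on [e] only. *)
pose I := {c : R | a 0 j < c < b 0 j}; pose J := {e : R | a 0 i < e < b 0 i}.
pose pt (e : J) (c : I) := upd (upd x0 i (sval e)) j (sval c).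
have ptX e c : X (pt e c).
  by apply: box_upd (svalP c); apply: box_upd (svalP e).
have ptj e c : pt e c 0 j = sval c by rewrite /pt upd_same.
have pti e c : pt e c 0 i = sval e by rewrite /pt upd_other// upd_same.
have ptE x : X x -> exists e c, pt e c = upd x k (x0 0 k).
  move=> xX; exists (exist (fun e => a 0 i < e < b 0 i) _ (mem_box i xX)).
  exists (exist (fun c => a 0 j < c < b 0 j) _ (mem_box j xX)).
  apply/rowP => l; rewrite !mxE/=.
  have [->|->|->] := ord3_cover l ij ik jk.
  - by rewrite (negPf ij) (negPf ik) eqxx.
  - by rewrite (negPf jk) eqxx.
  - by rewrite eq_sym (negPf jk) eq_sym (negPf ik) eqxx.
have gE x : X x -> exists e c,
    [/\ g k x = g k (pt e c), sval e = x 0 i & sval c = x 0 j].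
  move=> xX; have [e [c E]] := ptE _ xX; exists e, c; split.
  - by rewrite E (circle_space_const xX)//; exact: mem_box.
  - by rewrite -(pti e c) E upd_other.
  - by rewrite -(ptj e c) E upd_other.
have iI : inhabited I by exists; exists (x0 0 j); exact: mem_box.
have iJ : inhabited J by exists; exists (x0 0 i); exact: mem_box.
have [e0] := iJ; have [c0] := iI.
have : forall c : I, exists E : {vspace V}, \dim E = 2%N /\
    forall y, X y -> y 0 j = sval c -> (E <= g k y)%VS.
  move=> c; have [E dE gEy] := circle_spaces_common_line (ptX e0 c) ij ik jk.
  by exists E; split=> // y yX yc; apply: gEy; rewrite ?ptj.
move=> /choice[E EP].
have : forall e : J, exists F : {vspace V}, \dim F = 2%N /\
    forall y, X y -> y 0 i = sval e -> (F <= g k y)%VS.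
  move=> e; have [F dF gFy] := circle_spaces_common_line (ptX e c0) ji jk ik.
  by exists F; split=> // y yX yc; apply: gFy; rewrite ?pti.
move=> /choice[F FP].
have [||e c|e c|e c|[q q0 qg]|[Z [c [e [dZ gc ge]]]]|[P [c1 [c2 [dP gP]]]]] :=
  @incidence _ _ I J E F (fun e c => g k (pt e c)) iI iJ.
- by move=> c; have [] := EP c.
- by move=> e; have [] := FP e.
- exact: dim_circle_space.
- by have [_] := EP c; apply; rewrite ?ptj.
- by have [_] := FP e; apply; rewrite ?pti.
- exists q => // x xX.
  by have [e [c [-> _ _]]] := gE _ xX.
- have gc' x : X x -> x 0 j = sval c -> (g k x <= Z)%VS.
    move=> xX xc; have [e' [c' [-> _ cc']]] := gE _ xX.
    by rewrite (_ : c' = c)//; apply: val_inj; rewrite /= cc'.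
  have ge' x : X x -> x 0 i = sval e -> (g k x <= Z)%VS.
    move=> xX xc; have [e' [c' [-> ee' _]]] := gE _ xX.
    by rewrite (_ : e' = e)//; apply: val_inj; rewrite /= ee'.
  have mZ x : X x -> (g k x <= Z)%VS -> m x \in Z.
    by move=> xX /subvP; apply; have [] := mem_circle_space k x.
  have xX := ptX e c.
  (* Regulus case: [Z] contains the two surfaces x_j = c and x_i = e, hence gamma_k and all three
     tangents at their common point, which are five independent vectors. *)
  have : (5 <= \dim Z)%N.
    apply: (circle_space_sub_dim5 xX ij ik jk); first exact: gc.
    + apply: circle_space_sub => //.
      apply: filterS (near_itv_oo (mem_box i xX)) => s sab.
      apply: mZ; first exact: box_upd.
      by apply: gc'; [exact: box_upd|rewrite upd_other// ptj].
    + apply: circle_space_sub => //.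
      apply: filterS (near_itv_oo (mem_box j xX)) => s sab.
      apply: mZ; first exact: box_upd.
      by apply: ge'; [exact: box_upd|rewrite upd_other// pti].
  by rewrite leqNgt ltnS dZ.
(* Planar case: if gamma_k stayed in [P] along a piece of an i-th curve, [P] would also contain d_i
   m and so have dimension at least 4. *)
have gi c x : X x -> x 0 j = sval c ->
    (\forall e \near x 0 i, forall e' : J, sval e' = e -> (g k (pt e' c) <=
      P)%VS) ->
    False.
  move=> xX xc ge.
  have gkP s : X (upd x i s) ->
      (forall e' : J, sval e' = s -> (g k (pt e' c) <= P)%VS) ->
      (g k (upd x i s) <= P)%VS.
    move=> sX gs; have [e' [c' [-> ee' cc']]] := gE _ sX.
    rewrite (_ : c' = c); last by apply: val_inj; rewrite /= cc' upd_other.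
    by apply: gs; rewrite ee' upd_same.
  have : (4 <= \dim P)%N.
    apply: (circle_space_sub_dim4 xX ik).
      have := nbhs_singleton ge => /gkP; rewrite upd_id; exact.
    apply: circle_space_sub => //; near=> s.
    have sX : X (upd x i s).
      by apply: box_upd => //; near: s; exact: near_itv_oo (mem_box i xX).
    have [_ _ mg] := mem_circle_space k (upd x i s).
    by apply: subvP mg; apply: gkP => //; near: s.
  by rewrite leqNgt ltnS dP.
have [e1 ne1] : exists e, ~~ (g k (pt e c1) <= P)%VS.
  apply: contrapT => nE; apply: (gi c1 _ (ptX e0 c1) (ptj e0 c1)).
  near=> e => e' _; apply/negPn/negP => ne'; by apply: nE; exists e'.
(* For c1 the inclusion fails at e1, hence for all [e] near e1. There it must hold for c2, which
   [gi] excludes. *)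
exfalso; apply: (gi c2 _ (ptX e1 c2) (ptj e1 c2)).
have := circle_space_notin_near i (ptX e1 c1) ne1; rewrite !pti.
apply: filterS => e ne e' e'e; have [|//] := gP e'.
have E1 : pt e' c1 = upd (pt e1 c1) i e.
  apply/rowP => l; rewrite !mxE e'e.
  by have [->|->|->] := ord3_cover l ij ik jk;
    rewrite ?eqxx ?(eq_sym k) ?(negPf ij) ?(negPf ji) ?(negPf ik) ?(negPf jk).
by rewrite E1 (negPf ne).
Unshelve. all: by end_near. Qed.

End Core.

(** * Triply orthogonal systems *)

Section Embedding.
Context (R : realType) (n : nat).

Definition embed (i : 'I_n.+1) (c : R) (y : 'rV[R]_n) : 'rV[R]_n.+1 :=
  \row_l (if unlift i l is Some l' then y 0 l' else c).

Lemma embed_same i c y : embed i c y 0 i = c.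
Proof. by rewrite mxE unlift_none. Qed.

Lemma embed_lift i c y j : embed i c y 0 (lift i j) = y 0 j.
Proof. by rewrite mxE liftK. Qed.

Lemma col'_embed i c y : col' i (embed i c y) = y.
Proof. by apply/rowP => j; rewrite mxE embed_lift. Qed.

Lemma embed_col' i (x : 'rV[R]_n.+1) : embed i (x 0 i) (col' i x) = x.
Proof. by apply/rowP => l; rewrite mxE; case: unliftP => [j|] -> //; rewrite
  mxE. Qed.

Lemma embedD i c h w y : embed i c (h *: w + y) = h *: embed i 0 w + embed i c
  y.
Proof.
by apply/rowP => l; rewrite !mxE; case: unliftP => [j|] _; rewrite ?mxE// mulr0
  add0r.
Qed.

Lemma box_embed (a b : 'rV[R]_n.+1) i c y : a 0 i < c < b 0 i ->
  box (col' i a) (col' i b) y -> box a b (embed i c y).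
Proof.
move=> cab yM l; rewrite mxE; case: unliftP => [j|] -> //.
by have := yM j; rewrite !mxE.
Qed.

Lemma box_col' (a b x : 'rV[R]_n.+1) i : box a b x ->
  box (col' i a) (col' i b) (col' i x).
Proof. by move=> xX j; rewrite !mxE; exact: xX. Qed.

End Embedding.

Lemma embed_dir (R : realType) (n : nat) (i : 'I_n.+2) (j : 'I_n.+1) :
  embed i 0 (dir R j) = dir R (lift i j).
Proof.
apply/rowP => l; rewrite !mxE/=; case: unliftP => [l'|] ->.
  by rewrite mxE/= (inj_eq lift_inj).
by rewrite (negPf (neq_lift _ _)).
Qed.

Section SmoothEmbed.
Context (R : realType) (n : nat) (W : normedModType R).

Lemma differentiable_embed (i : 'I_n.+2) (c : R) y :
  differentiable (embed i c : 'rV[R]_n.+1 -> _) y.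
Proof.
have -> : (embed i c : 'rV[R]_n.+1 -> _) =
    cst (c *: dir R i) + \sum_(l < n.+1) (fun y : 'rV[R]_n.+1 => y 0 l *: dir R
      (lift i l)).
  apply/funext => z; apply/rowP => k; rewrite mxE /cst !fctE fct_sumE mxE
    summxE.
  case: unliftP => [l ->|->].
    rewrite (bigD1 l)//= big1 => [|j jl]; rewrite !mxE/= ?eqxx.
      by rewrite eq_sym (negPf (neq_lift _ _)) mulr0 add0r addr0 mulr1.
    by rewrite (inj_eq lift_inj) eq_sym (negPf jl) mulr0.
  rewrite !mxE/= eqxx mulr1 big1 ?addr0// => j _.
  by rewrite !mxE/= (negPf (neq_lift _ _)) mulr0.
apply: differentiableD; first exact: differentiable_cst.
apply: differentiable_sum => l; apply: differentiableZl.
exact: differentiable_coord.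
Qed.

(** The slice map is affine with linear part [embed i 0], so iterated derivatives on the slice are
    restrictions of iterated derivatives on the box. *)
Lemma derive_embed (f : 'rV[R]_n.+2 -> W) (i : 'I_n.+2) (c : R) v :
  'D_v (f \o embed i c) = 'D_(embed i 0 v) f \o embed i c.
Proof.
apply/funext => y; rewrite /derive /=.
set g1 := fun h => h^-1 *: _; set g2 := fun h => h^-1 *: _.
suff -> : g1 = g2 by [].
by apply/funext => h; rewrite /g1 /g2 /= embedD.
Qed.

Lemma smooth_on_embed (U : set 'rV[R]_n.+2) (M : set 'rV[R]_n.+1)
    (f : 'rV[R]_n.+2 -> W) i c :
  (forall y, M y -> U (embed i c y)) -> smooth_on U f ->
  smooth_on M (f \o embed i c).
Proof.
move=> MU fU l y yM.
have -> : foldr (fun v g => 'D_v g) (f \o embed i c) l =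
    foldr (fun v g => 'D_v g) f (map (embed i 0) l) \o embed i c.
  by elim: l => //= v l ->; rewrite derive_embed.
apply: differentiable_comp; first exact: differentiable_embed.
exact/fU/MU.
Qed.

Lemma smooth_on_derive (V : normedModType R) (U : set V) (f : V -> W) v :
  smooth_on U f -> smooth_on U ('D_v f).
Proof. by move=> fU l x xU; have := fU (rcons l v) x xU; rewrite foldr_rcons.
  Qed.

End SmoothEmbed.

(** * Normals and tangents of a triply orthogonal system *)

Section Triple.
Context (R : realType) (G : 'M[R]_6).
Local Notation V := 'rV[R]_6.
Local Notation B := (lie_form G).
Context (geoG : lie_geometry G) (p : V) (pp : B p p = -1).
Context (a b : 'rV[R]_3) (S : 'I_3 -> R -> 'rV[R]_2 -> {vspace V}).
Context (m : 'rV[R]_3 -> V).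
Local Notation X := (box a b).
Context (tos : triply_orthogonal_system G p a b S m).

Definition tangent i x : V := 'D_(dir R i) m x.
Definition tangent2 i j x : V := 'D_(dir R i) (tangent j) x.
Local Notation d := tangent.
Local Notation dd := tangent2.

Let lC := lieC geoG.

Lemma tos_smooth : smooth_on X m.
Proof. by have [_ _ []] := tos. Qed.

Lemma tos_smooth_d i : smooth_on X (d i).
Proof. exact/smooth_on_derive/tos_smooth. Qed.

Lemma tos_smooth_dd i j : smooth_on X (dd i j).
Proof. exact/smooth_on_derive/tos_smooth_d. Qed.

Lemma tos_der_m i x : X x -> is_derive x (dir R i) m (d i x).
Proof. by move=> /(tos_smooth [::])/diff_derivable H; exact: DeriveDef. Qed.

Lemma tos_der_d i j x : X x -> is_derive x (dir R i) (d j) (dd i j x).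
Proof. by move=> /(tos_smooth_d j [::])/diff_derivable H; exact: DeriveDef. Qed.

Lemma tos_diff_d i x : X x -> differentiable (d i) x.
Proof. exact: (tos_smooth_d i [::]). Qed.

Lemma tos_diff_dd i j x : X x -> differentiable (dd i j) x.
Proof. exact: (tos_smooth_dd i j [::]). Qed.

Lemma tos_m_neq0 x : X x -> m x != 0.
Proof. by move=> xX; have [_ _ [_ /(_ x xX)[[]]]] := tos. Qed.

Lemma tos_null x : X x -> B (m x) (m x) = 0.
Proof. by move=> xX; have [_ _ [_ /(_ x xX)[[]]]] := tos. Qed.

Lemma tos_p x : X x -> B (m x) p = 0.
Proof. by move=> xX; have [_ _ [_ /(_ x xX)[]]] := tos. Qed.

Let d_m' x i : X x -> B (d i x) (m x) = 0.
Proof. exact: (d_m geoG tos_der_m tos_null). Qed.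

Let d_p' x i : X x -> B (d i x) p = 0.
Proof. exact: (d_p tos_der_m tos_p). Qed.

Lemma tos_mem i x : X x -> m x \in contact_at S i x.
Proof.
move=> xX; have [_ _ _ _ /(_ i (lift i 0) x (neq_lift _ _) xX)[]] := tos.
by [].
Qed.

Lemma tos_legendre i x : X x -> legendre_map G (box (col' i a) (col' i b)) (S i
  (x 0 i)).
Proof. by move=> xX; have [+ _ _ _ _] := tos; apply; exact: xX. Qed.

(** Polarization: the quadratic form vanishes on the whole contact element. *)
Lemma contact_m i x s : X x -> s \in contact_at S i x -> B s (m x) = 0.
Proof.
move=> xX sf; have [cE _ _] := tos_legendre i xX.
have [_ iso] := cE _ (box_col' i xX).
have := iso _ (memvD sf (tos_mem i xX)).
have := iso _ sf; rewrite !lieE tos_null// (lC (m x) s) => ->; lra.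
Qed.

(** The Legendre condition concerns sections. It is applied to a local frame of the contact
    elements, which spans [s] at the point, and to the section [m] restricted to the surface, whose
    derivative is d_j m. *)
Lemma contact_d i j x s : X x -> i != j -> s \in contact_at S i x ->
  B s (d j x) = 0.
Proof.
move=> xX ij sf; have [j' jE] : exists j', j = lift i j'.
  by case: (unliftP i j) ij => [j'|] ->; [exists j'|rewrite eqxx].
have [_ sm leg] := tos_legendre i xX.
have [N [t [oN Nx NM tN tb]]] := sm _ (box_col' i xX).
have NX y : N y -> X (embed i (x 0 i) y).
  by move=> /NM; apply: box_embed; exact: xX.
have sec : smooth_section N (S i (x 0 i)) (m \o embed i (x 0 i)).
  split; first exact: (smooth_on_embed NX tos_smooth).
  by move=> y /NX yX; have := tos_mem i yX; rewrite /contact_at embed_same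
    col'_embed.
have E : 'D_(dir R j') (m \o embed i (x 0 i)) (col' i x) = d j x.
  have /(congr1 (fun f => f (col' i x)))/= -> :=
    derive_embed m i (x 0 i) (dir R j').
  by rewrite embed_dir embed_col' jE.
rewrite -E lC; have := sf; rewrite /contact_at -(span_basis (tb _ Nx)).
apply: span_perp => _ /mapP[l _ ->]; rewrite lC; apply: (leg N) => //.
split; first exact: tN.
by move=> y Ny; apply: (basis_mem (tb _ Ny)); rewrite /= map_f ?mem_enum.
Qed.

(** This is a unit normal in p^perp, determined modulo [m]. The contact element has a vector [s]
    with <s,p> != 0, since otherwise span(s, m, p) would be a seminegative 3-space; scaling to <s,p>
    = -1 and subtracting [p] gives [n]. *)
Lemma contact_normal i x : X x -> exists n,
  [/\ n + p \in contact_at S i x, B n p = 0, B n n = 1, B n (m x) = 0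
    & forall j, i != j -> B n (d j x) = 0].
Proof.
move=> xX; have [cE _ _] := tos_legendre i xX.
have [d2 iso] := cE _ (box_col' i xX); have mf := tos_mem i xX.
have m0 := tos_m_neq0 xX.
have [s sf sm] : exists2 s, s \in contact_at S i x & s \notin <[m x]>%VS.
  apply: contrapT => H; have : (contact_at S i x <= <[m x]>)%VS.
    by apply/subvP => s sf; apply/negPn/negP => sm; apply: H; exists s.
  by move=> /dimvS; rewrite d2 dim_vline m0.
have s_m := contact_m xX sf; have s_s := iso _ sf.
have sp : B s p != 0.
  apply/eqP => sp; apply: (@no_seminegative _ _ geoG <<[:: s; m x; p]>>%VS).
    suff : free [:: s; m x; p] by rewrite /free => /eqP ->.
    rewrite !free_cons nil_free andbT !span_cons span_nil addv0.
    apply/and3P; split.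
    - apply: contra sm => /memv_addP[_ /vlineP[c ->]] [_ /vlineP[e ->]] sE.
      have := sp; rewrite sE !lieE tos_p// pp => e0.
      have -> : e = 0 by lra.
      by rewrite scale0r addr0 memvZ// memv_line.
    - apply/negP => /vlineP[c mE]; have := tos_p xX; rewrite mE lieE pp => c0.
      by move: m0; rewrite mE (_ : c = 0) ?scale0r ?eqxx//; lra.
    - by rewrite memv0; apply/eqP => p0; move: pp; rewrite p0 lie0l; lra.
  move=> u; rewrite !span_cons span_nil addv0.
  move=> /memv_addP[_ /vlineP[c ->]] [_ /memv_addP[_ /vlineP[e ->]] [_
    /vlineP[f ->]] ->] ->.
  rewrite !lieE s_s s_m sp tos_null// tos_p// pp !(lC p) sp tos_p// (lC (m x))
    s_m.
  have := sqr_ge0 f; rewrite expr2; lra.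
pose s' := (- (B s p)^-1) *: s.
have s'f : s' \in contact_at S i x by rewrite memvZ.
have s'p : B s' p = -1 by rewrite lieZl mulNr mulVf.
have mp := tos_p xX.
exists (s' - p); split.
- by rewrite subrK.
- by rewrite lieDl lieNl s'p pp; ring.
- by rewrite !lieDl !lieNl !lieDr !lieNr (lC p) s'p pp (iso _ s'f); ring.
- by rewrite lieDl lieNl (lC p) mp (contact_m xX s'f); ring.
- by move=> j ij; rewrite lieDl lieNl (lC p) d_p'// (contact_d xX ij s'f); ring.
Qed.

(** The three normals are orthonormal and, with [m], [p] and an auxiliary [z], form a frame. As d_i
    m is orthogonal to [m], [p] and the other two normals, only multiples of [m] and [n i]
    remain. *)
Lemma tangent_normal x : X x -> exists n : 'I_3 -> V, exists al be : 'I_3 -> R,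
  [/\ forall i, d i x = al i *: m x + be i *: n i,
      forall i, B (n i) (m x) = 0, forall i, B (n i) (n i) = 1
    & forall i j, i != j -> B (n i) (n j) = 0].
Proof.
move=> xX; have mm := tos_null xX; have mp := tos_p xX.
have /choice[n nP] := fun i => @contact_normal i x xX.
have nn i j : i != j -> B (n i) (n j) = 0.
  move=> ij; have [nif nip nii nim _] := nP i; have [njf njp njj njm _] := nP j.
  have sph k : n k + p \in contact_at S k x -> B (n k) p = 0 -> B (n k) (n k) =
    1 ->
      sphere G (n k + p).
    move=> _ nkp nkk; split.
      apply/eqP => E; have : B (n k + p) p = 0 by rewrite E lie0l.
      by rewrite lieDl nkp pp; lra.
    by rewrite !lieE nkk nkp pp (lC p) nkp; ring.
  have [_ _ _ _ /(_ i j x ij xX)[_ _ H]] := tos.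
  have := H _ _ (sph i nif nip nii) (sph j njf njp njj) nif njf.
  rewrite /orthogonal_spheres !lieE njp nip pp (lC p) njp; lra.
have [w mw] : exists w, B w (m x) != 0.
  apply: contrapT => H; have := tos_m_neq0 xX; rewrite (lie_nondegenerate geoG
    (v := m x)) ?eqxx//.
  by move=> w; apply/eqP/negPn/negP => mw; apply: H; exists w; rewrite lC.
have [z zm zp] : exists2 z, B z (m x) != 0 & B z p = 0.
  exists (w + B w p *: p); first by rewrite lieDl lieZl (lC p) mp mulr0 addr0.
  by rewrite lieDl lieZl pp; ring.
(* The coefficient of [m] is the one that makes the difference orthogonal to [z]. *)
exists n, (fun i => B (d i x - B (d i x) (n i) *: n i) z / B (m x) z),
  (fun i => B (d i x) (n i)); split=> //; last 2 first.
- by move=> i; have [] := nP i.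
- by move=> i; have [] := nP i.
move=> i; apply/eqP; rewrite -subr_eq0; apply/eqP.
have [_ nip nii nim _] := nP i.
apply: (@frame_perp _ G geoG p (m x) z n pp mm mp zm).
- by move=> l; have [] := nP l.
- by move=> l; have [] := nP l.
- exact: nn.
- by move=> l; have [_ _ -> _ _] := nP l.
- by rewrite !lieE d_m'// mm nim; ring.
- by rewrite !lieE d_p'// mp nip; ring.
- rewrite !lieE (lC (m x) z); field; exact: zm.
move=> l; have [_ _ _ nlm nld] := nP l.
rewrite !lieE (lC (m x) (n l)) nlm; have [<-|il] := eqVneq i l.
  by rewrite nii; ring.
by rewrite (lC _ (n l)) nld 1?eq_sym// nn//; ring.
Qed.

Lemma tos_orth x i j : X x -> i != j -> B (d i x) (d j x) = 0.
Proof.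
move=> xX ij; have [n [al [be [dE nm n1 nn]]]] := tangent_normal xX.
rewrite (dE i) (dE j) !lieE tos_null// !(lC (m x)) !nm nn//; ring.
Qed.

(** The product is the square of the [n i]-coefficient of d_i m; if that were 0, d_i m would be a
    multiple of [m], against the immersion condition. *)
Lemma tos_imm x i : X x -> 0 < B (d i x) (d i x).
Proof.
move=> xX; have [n [al [be [dE nm n1 nn]]]] := tangent_normal xX.
have -> : B (d i x) (d i x) = be i ^+ 2.
  by rewrite (dE i) !lieE tos_null// !(lC (m x)) !nm n1; ring.
rewrite exprn_even_gt0//=; apply/eqP => be0.
have [_ _ _ imm _] := tos; have : d i x \notin <[m x]>%VS.
  apply: imm => //; apply/eqP => /matrixP/(_ 0 i)/eqP.
  by rewrite !mxE !eqxx oner_eq0.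
by rewrite dE be0 scale0r addr0 memvZ ?memv_line.
Qed.

End Triple.

(** * The congruences of orthogonal trajectories *)

Section CircularTrajectories.
Context (R : realType) (G : 'M[R]_6).
Local Notation V := 'rV[R]_6.
Local Notation B := (lie_form G).
Context (geoG : lie_geometry G) (p : V) (pp : B p p = -1).
Context (a b : 'rV[R]_3) (S : 'I_3 -> R -> 'rV[R]_2 -> {vspace V}).
Context (m : 'rV[R]_3 -> V).
Local Notation X := (box a b).
Context (ab : forall i, a 0 i < b 0 i).
Context (tos : triply_orthogonal_system G p a b S m).
Context (circ : forall (i j : 'I_3) (c d : R), i != j ->
  a 0 i < c < b 0 i -> a 0 j < d < b 0 j ->
  exists g, circle G p g /\
    forall x, X x -> x 0 i = c -> x 0 j = d -> m x \in g).
Local Notation d := (tangent m).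
Local Notation dd := (tangent2 m).
Local Notation g := (circle_space m d dd).

Let lC := lieC geoG.
Let der_m := tos_der_m tos.
Let der_d := tos_der_d tos.
Let orth := tos_orth geoG pp tos.
Let imm := tos_imm geoG pp tos.
Let null := tos_null tos.
Let perp_p := tos_p tos.

Lemma dim_circle h : circle G p h -> \dim h = 3%N.
Proof.
move=> [[Y [Yb _]] _]; have := basis_free Yb; have := span_basis Yb.
by rewrite /free => -> /eqP ->; rewrite size_tuple.
Qed.

Lemma trajectory_circle x k : X x -> exists2 h, circle G p h &
  forall s, a 0 k < s < b 0 k -> m (upd x k s) \in h.
Proof.
move=> xX; have [i [j /and3P[ik jk ij]]] := other_indices k.
have [h [hc hm]] := circ ij (xX i) (xX j); exists h => // s sab.
by apply: hm; [exact: box_upd|rewrite upd_other|rewrite upd_other].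
Qed.

Let m_circ x k : X x -> exists2 h : {vspace V}, \dim h = 3%N &
  forall s, a 0 k < s < b 0 k -> m (upd x k s) \in h.
Proof. by move=> /(trajectory_circle k)[h /dim_circle dh hm]; exists h. Qed.

Let gP := circle_spaceP geoG pp der_m der_d null perp_p orth imm.

Lemma circle_circle_space k x : X x -> circle G p (g k x).
Proof.
move=> xX; have [h hc hm] := trajectory_circle k xX.
suff /eqP -> : g k x == h by [].
have gh : (g k x <= h)%VS.
  apply: (circle_space_sub der_m der_d xX).
  by apply: filterS (near_itv_oo (xX k)) => t /hm.
rewrite -(dimv_leqif_eq gh) (dim_circle hc).
by rewrite (dim_circle_space geoG pp der_m der_d null perp_p orth imm).
Qed.

(** For [s] in the contact element, s + <s,p>p is orthogonal to [p] and to the curvature spheres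
    S_ki, so it lies in gamma_k and is orthogonal to every sphere [t] through the circle. *)
Lemma contact_meets_orthogonally k x : X x ->
  meets_orthogonally G p (contact_at S k x) (g k x).
Proof.
move=> xX; have [_ _ mg] := mem_circle_space m d dd k x.
split.
  exists (m x); split=> //; last exact: (tos_mem tos).
  by split; [split; [exact: (tos_m_neq0 tos)|exact: null]|exact: perp_p].
move=> s t _ sf _ tg; rewrite /orthogonal_spheres.
have pg u : u \in g k x -> B u p = 0 by move=> /(gP _ _ xX)[].
have sm := contact_m geoG tos xX sf.
have ng : s + B s p *: p \in g k x.
  apply/(gP _ _ xX); split; first by rewrite !lieE pp; ring.
  move=> i ik; have ki : k != i by rewrite eq_sym.
  rewrite curvature_sphereE !lieE sm (contact_d geoG tos xX ki sf) !(lC p).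
  by rewrite perp_p// (d_p der_m perp_p)//; ring.
have := tg _ ng; have := pg _ ng; rewrite !lieE pp !(lC t) !(lC p) => _.
by rewrite (lC t p); lra.
Qed.

(** The midpoint is an arbitrary choice: gamma_k does not change along the k-th curve. *)
Definition congruence k y := g k (embed k ((a 0 k + b 0 k) / 2) y).

Let mid k : a 0 k < (a 0 k + b 0 k) / 2 < b 0 k.
Proof. by have := ab k => ?; apply/andP; split; lra. Qed.

Lemma congruenceE k x : X x -> congruence k (col' k x) = g k x.
Proof.
move=> xX; rewrite -(circle_space_const geoG pp der_m der_d (tos_diff_d tos)
  null perp_p orth imm m_circ xX (mid k)).
congr (g k _); apply/rowP => l; rewrite !mxE; case: unliftP => [l'|] -> .
  by rewrite eq_sym (negPf (neq_lift _ _)) mxE.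
by rewrite eqxx.
Qed.

Lemma smooth_congruence k :
  smooth_subspaces (box (col' k a) (col' k b)) 3 (congruence k).
Proof.
set M := box _ _; move=> y yM.
have MX z : M z -> X (embed k ((a 0 k + b 0 k) / 2) z).
  by move=> zM; apply: box_embed.
pose t : 3.-tuple ('rV[R]_3 -> V) := [tuple dd k k; d k; m].
exists M, (fun l => tnth t l \o embed k ((a 0 k + b 0 k) / 2)); split=> //.
- exact: open_box.
- move=> l; apply: (smooth_on_embed MX).
  have /allP : all (fun f => `[< smooth_on X f >]) t.
    by rewrite /= !asboolT//; [exact: (tos_smooth tos)|
      exact: (tos_smooth_d tos)|exact: (tos_smooth_dd tos)].
  by move=> /(_ _ (mem_tnth l t))/asboolP.
move=> z zM; pose u := embed k ((a 0 k + b 0 k) / 2) z; have uX : X u by exact: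
  MX.
have -> : [tuple (tnth t l \o embed k ((a 0 k + b 0 k) / 2)) z | l < 3] =
    [tuple dd k k u; d k u; m u] :> seq V.
  by rewrite /= !enum_ordSl enum_ord0/= !(tnth_nth m).
rewrite basisEfree subvv andTb; apply/andP; split; last first.
  by rewrite -(eqP (circle_free geoG pp der_m der_d null perp_p orth imm k uX)).
exact: (circle_free geoG pp der_m der_d null perp_p orth imm k uX).
Qed.

(** The vector common to all gamma_k is orthogonal to [p] and serves as space form vector; one
    congruence of lines is then orthogonal to every surface of the family. *)
Lemma trajectories_space_form_lines k : exists q, [/\ space_form_vector G p q,
  normal_line_congruence G p q (box (col' k a) (col' k b)) (congruence k)
  & forall c, a 0 k < c < b 0 k ->
     orthogonal_surface G p (box (col' k a) (col' k b)) (congruence k) (S k c)].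
Proof.
have x0X : X (\row_l ((a 0 l + b 0 l) / 2)) by move=> l; rewrite mxE; exact:
  mid.
have [q q0 qg] := common_circle_vector geoG pp der_m der_d (tos_diff_d tos)
  (tos_diff_dd tos) null perp_p orth imm m_circ k x0X.
have surf c : a 0 k < c < b 0 k ->
    orthogonal_surface G p (box (col' k a) (col' k b)) (congruence k) (S k c).
  move=> cab; split; first by have [+ _ _ _ _] := tos; apply.
  move=> y yM; have xX := box_embed cab yM.
  have := contact_meets_orthogonally k xX.
  by rewrite -congruenceE// /contact_at embed_same col'_embed.
exists q; split=> //.
  by split=> //; have /(gP _ _ x0X)[] := qg _ x0X.
split; last by exists (S k ((a 0 k + b 0 k) / 2)); exact/surf/mid.
split; first exact: smooth_congruence.
move=> y yM; have xX := box_embed (mid k) yM.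
by split; [exact: circle_circle_space|exact: qg].
Qed.

End CircularTrajectories.

Theorem proposition21 (R : realType) (G : 'M[R]_6) (p : 'rV[R]_6)
    (a b : 'rV[R]_3) (S : 'I_3 -> R -> 'rV[R]_2 -> {vspace 'rV[R]_6})
    (m : 'rV[R]_3 -> 'rV[R]_6) :
  lie_geometry G -> point_sphere_complex G p ->
  (forall i, a 0 i < b 0 i) ->
  dupin_cyclidic_system G p a b S m ->
  forall i : 'I_3, exists q : 'rV[R]_6,
    [/\ space_form_vector G p q,
        parallel_surfaces G p q (box (col' i a) (col' i b))
          [set S i c | c in [set c | a 0 i < c < b 0 i]]
      & forall c, a 0 i < c < b 0 i ->
          dupin_cyclide G (box (col' i a) (col' i b)) (S i c) ->
          exists C, normal_line_congruence G p q (box (col' i a) (col' i b)) C /\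
            orthogonal_surface G p (box (col' i a) (col' i b)) C (S i c)].
Proof.
move=> geoG pp ab [tos circ _] i.
have [q [sq nC surf]] := trajectories_space_form_lines geoG pp ab tos circ i.
exists q; split=> //.
  by exists (congruence a b m i); split=> // _ [c cab <-]; exact: surf.
by move=> c cab _; exists (congruence a b m i); split=> //; exact: surf.
Qed.
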